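(* Let $\epsilon_0>0$, $\alpha>0$, and run $\mathrm{PMWG}(X,F,\epsilon_0,0,\alpha,n)$, so that its noise function is $\xi_t=\frac{\alpha^2n^{1/2}}{162\log(Nn)}\epsilon_0t^{1/2}$; write $\Delta_t=1/t$. Then this algorithm is $(\epsilon,0)$-differentially private for $$\epsilon=\Big(1+\frac{81}{2\alpha^2}\log N\Big)\xi_n\Delta_n+\frac{81}{2\alpha^2}\sum_{t=n+1}^\infty\Big(\frac{\log N}{t}+\frac{\log(t-1)}{t}+\log\frac{t}{t-1}\Big)\xi_t\Delta_t .$$
   Context: Data universe $[N]$. A database of size $t$ is a histogram $x\in\Delta([N])\subseteq\mathbb R^N$ with $x^i=n_i/t$, $n_i\in\mathbb N$, $\sum_i n_i=t$; same-size databases are neighboring if they differ in one entry. A linear query is $f\in[0,1]^N$ with $f(x)=\langle f,x\rangle$. A database stream $X=\{x_t\}_{t\ge n}$ has $x_t$ of size $t$, $x_{t+1}$ obtained from $x_t$ by adding one entry; streams $X,X'$ are neighboring if for some $t\ge n$, $x_\tau=x'_\tau$ for $n\le\tau<t$ and $x_\tau,x'_\tau$ neighboring for $\tau\ge t$. A query stream $F=\{\{f_{t,j}\}_{j=1}^{\ell_t}\}_{t\ge n}$ of linear queries, $f_{t,j}$ arriving when the database has size $t$, may be chosen adaptively. An algorithm is $(\epsilon,0)$-differentially private if for all neighboring streams and every set $S$ of output transcripts, $\Pr[\mathcal A(X)\in S]\le e^\epsilon\Pr[\mathcal A(X')\in S]$. $\mathrm{Lap}(b)$ has density $\frac1{2b}e^{-|z|/b}$.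 Subroutines (threshold $T$, noise function $\xi$, on the database stream). NATG: when started it draws $\eta\sim\mathrm{Lap}(2)$; on each subsequent query $g$ arriving at time $t$ it draws fresh $\nu\sim\mathrm{Lap}(4/\xi_t)$; if $g(x_t)+\nu\ge T+\eta/\xi_t$ it outputs $g(x_t)+Z$, $Z\sim\mathrm{Lap}(8/\xi_t)$ fresh, and halts; otherwise outputs $\bot$. NSG: processes queries in order; whenever a query arrives and no NATG instance is running, it starts a fresh NATG instance with the same $T,\xi$; it outputs the running instance's answer. $\mathrm{PMWG}(X,F,\epsilon_0,0,\alpha,n)$ with noise function $\xi$: run NSG with $T=2\alpha/3$ and noise $\xi$. Maintain a public histogram $y$, initially $y^i=1/N$, and a hard-query count $H=0$; let $b_t=\frac{\log N}{t}+\frac{\log(t-1)}{t}+\log\frac{t}{t-1}$. On query $f=f_{t,j}$: (1) if the previous query arrived at time $t'<t$, set $y^i\leftarrow\frac{t'}{t}y^i+\frac{t-t'}{t}\cdot\frac1N$; (2) submit to NSG the queries $g_1(x)=f(x)-f(y)$ and $g_2(x)=f(y)-f(x)$, getting $a_1,a_2\in\mathbb R\cup\{\bot\}$; (3) if $a_1=a_2=\bot$, output $f(y)$; (4) otherwise set $H\leftarrow H+1$; if $H>\frac{36}{\alpha^2}(\log N+\sum_{\tau=n+1}^t b_\tau)$ halt with output $\bot$; else output $a=f(y)+a_1$ if $a_1\in\mathbb R$ and $a=f(y)-a_2$ otherwise; let $r=f$ if $a<f(y)$ and $r=1-f$ otherwise, and update $y^i\leftarrow y^i e^{-\alpha r^i/6}/\sum_{i'}y^{i'}e^{-\alpha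 r^{i'}/6}$. *)

(* Defs.v *)
From HB Require Import structures.
From mathcomp Require Import all_boot all_order all_algebra.
From mathcomp Require Import all_classical all_reals all_analysis.

Set Implicit Arguments.
Unset Strict Implicit.
Unset Printing Implicit Defensive.

Import Order.TTheory GRing.Theory Num.Theory.
Import numFieldNormedType.Exports.

Local Open Scope classical_set_scope.
Local Open Scope ring_scope.

Section databases.
Context {R : realType} {N : nat}.
Implicit Types x f : 'rV[R]_N.

Definition is_database (t : nat) x : Prop :=
  exists2 c : 'I_N -> nat, (\sum_i c i = t)%N &
    forall i, x ord0 i = (c i)%:R / t%:R.

(* One of the t entries of x, equal to i, is replaced by an entry j <> i. *)
Definition neighboring_databases (t : nat) x x' : Prop :=
  [/\ is_database t x, is_database t x' &
      exists i j : 'I_N, i != j /\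
        x' = x - t%:R^-1 *: delta_mx ord0 i + t%:R^-1 *: delta_mx ord0 j].

(* x_t is [X t]; the values [X t] for t < n are irrelevant. *)
Definition is_database_stream (n : nat) (X : nat -> 'rV[R]_N) : Prop :=
  (forall t, (n <= t)%N -> is_database t (X t)) /\
  (forall t, (n <= t)%N -> exists i : 'I_N,
     t.+1%:R *: X t.+1 = t%:R *: X t + delta_mx ord0 i).

Definition neighboring_streams (n : nat) (X X' : nat -> 'rV[R]_N) : Prop :=
  exists t, [/\ (n <= t)%N,
    forall s, (n <= s < t)%N -> X s = X' s &
    forall s, (t <= s)%N -> neighboring_databases s (X s) (X' s)].

Definition is_linear_query f : Prop := forall i, 0 <= f ord0 i <= 1.

Definition qeval f x : R := \sum_i f ord0 i * x ord0 i.

End databases.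

Section transcripts.
Context {R : realType}.

(* Entry k is the output on the k-th query.  [None] is the output bot; the
   entries after the algorithm has halted or the query stream has ended are
   [None] as well. *)
Definition transcript := nat -> option R.

Definition transcript_cylinders : set (set transcript) :=
  [set A | exists (k : nat) (B : set R), measurable B /\
     A = [set tau : transcript | exists2 r, tau k = Some r & B r]].

Definition transcript_measurable : set (set transcript) :=
  <<s transcript_cylinders >>.

End transcripts.
Arguments transcript : clear implicits.

(* An adaptively chosen query stream, its queries f_{t,j} being listed in order
   of arrival: after the outputs h, the next query is f and arrives at time t if
   [F h = Some (t, f)], and no query is left if [F h = None]. *)
Definition query_strategy (R : realType) (N : nat) :=
  seq (option R) -> option (nat * 'rV[R]_N).

Section query_streams.
Context {R : realType} {N : nat}.

(* The fourth condition says that every l_t is finite; the last one is the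
   measurability of the next query as a function of the past outputs. *)
Definition is_query_stream (n : nat) (F : query_strategy R N) : Prop :=
  [/\ forall h t f, F h = Some (t, f) -> (n <= t)%N,
      forall h t f, F h = Some (t, f) -> is_linear_query f,
      forall h o t f t' f', F h = Some (t, f) ->
        F (rcons h o) = Some (t', f') -> (t <= t')%N,
      forall (tau : transcript R) t, exists K, forall k s f, (K <= k)%N ->
        F (mkseq tau k) = Some (s, f) -> (t < s)%N &
      forall k t (i : 'I_N) (B : set R), measurable B ->
        transcript_measurable [set tau : transcript R |
          exists2 f, F (mkseq tau k) = Some (t, f) & B (f ord0 i)]].

End query_streams.

(* The random draws of the algorithm.  [k] is the index of the query in the
   query stream, [t] its arrival time, and the boolean tells whether g_1 (false)
   or g_2 (true) is being submitted.  [Eta k b] is the draw of the NATG instance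
   started, if any, on the arrival of that submission; [Nu] and [Zeta] are the
   draws nu and Z for that submission. *)
Inductive draw : Type :=
| Eta of nat & bool
| Nu of nat & nat & bool
| Zeta of nat & nat & bool.

Definition draw_scale (R : realType) (xi : nat -> R) (e : draw) : R :=
  match e with
  | Eta _ _ => 2
  | Nu t _ _ => 4 / xi t
  | Zeta t _ _ => 8 / xi t
  end.

(* Draws attached to times before n are never used. *)
Definition draw_used (n : nat) (e : draw) : bool :=
  match e with
  | Eta _ _ => true
  | Nu t _ _ | Zeta t _ _ => (n <= t)%N
  end.

Section noise.
Context {R : realType}.

Definition laplace_pdf (b z : R) : R := (2 * b)^-1 * expR (- `|z| / b).

Context {d : measure_display} {Omega : measurableType d}
  (P : probability Omega R).

Definition laplace_distributed (X : {RV P >-> R}) (b : R) : Prop :=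
  forall A : set R, measurable A ->
    distribution P X A = (\int[lebesgue_measure]_(z in A) (laplace_pdf b z)%:E)%E.

Definition mutually_independent (I : Type) (X : I -> {RV P >-> R}) : Prop :=
  forall (m : nat) (e : 'I_m -> I), injective e ->
  forall B : 'I_m -> set R, (forall j, measurable (B j)) ->
    P (\bigcap_j (X (e j) @^-1` B j)) =
    (\prod_(j < m) P (X (e j) @^-1` B j))%E.

Definition is_laplace_noise (n : nat) (xi : nat -> R)
    (W : draw -> {RV P >-> R}) : Prop :=
  mutually_independent W /\
  forall e, draw_used n e -> laplace_distributed (W e) (draw_scale xi e).

End noise.

Section pmwg.
Context {R : realType} {N : nat}.
Implicit Types (x y f : 'rV[R]_N) (g : 'rV[R]_N -> R) (w : draw -> R).

(* One query to a running NATG instance with initial draw [eta]; [xi] is the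
   value xi_t of the noise function.  The instance halts iff the answer is not
   [None]. *)
Definition natg (T xi eta nu z : R) g x : option R :=
  if T + eta / xi <= g x + nu then Some (g x + z) else None.

(* The state of NSG is the draw eta of the running NATG instance, or [None] if
   no instance is running. *)
Definition nsg (T : R) (xi : nat -> R) w (k t : nat) (b : bool)
    (running : option R) g x : option R * option R :=
  let eta := odflt (w (Eta k b)) running in
  let a := natg T (xi t) eta (w (Nu t k b)) (w (Zeta t k b)) g x in
  (a, if a is Some _ then None else Some eta).

Definition bt (t : nat) : R :=
  ln N%:R / t%:R + ln t.-1%:R / t%:R + ln (t%:R / t.-1%:R).

Definition hard_query_bound (n : nat) (alpha : R) (t : nat) : R :=
  36 / alpha ^+ 2 * (ln N%:R + \sum_(n.+1 <= s < t.+1) bt s).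

Definition mw_update (alpha : R) y (r : 'rV[R]_N) : 'rV[R]_N :=
  let u i := y ord0 i * expR (- alpha * r ord0 i / 6) in
  \row_i (u i / \sum_i' u i').

(* [last] is the arrival time of the previous query, if any. *)
Definition mix_uniform (last : option nat) (t : nat) y : 'rV[R]_N :=
  if last is Some t' then
    if (t' < t)%N then
      \row_i (t'%:R / t%:R * y ord0 i + (t - t')%:R / t%:R * N%:R^-1)
    else y
  else y.

Record pmwg_state := PmwgState {
  st_done : bool;             (* PMWG has halted or the queries have ended *)
  st_last : option nat;       (* arrival time of the previous query *)
  st_hist : 'rV[R]_N;         (* public histogram y *)
  st_hard : nat;              (* hard-query count H *)
  st_nsg : option R           (* state of NSG *)
}.

Definition pmwg_init : pmwg_state :=
  PmwgState false None (const_mx N%:R^-1) 0 None.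

(* The processing of the k-th query f, arriving at time t. *)
Definition pmwg_query (n : nat) (alpha : R) (xi : nat -> R) w (k t : nat) f x
    (s : pmwg_state) : option R * pmwg_state :=
  let T := 2 * alpha / 3 in
  let y := mix_uniform (st_last s) t (st_hist s) in
  let fy := qeval f y in
  let: (a1, run1) :=
    nsg T xi w k t false (st_nsg s) (fun z => qeval f z - fy) x in
  let: (a2, run2) :=
    nsg T xi w k t true run1 (fun z => fy - qeval f z) x in
  let answer :=
    match a1, a2 with
    | Some v, _ => Some (fy + v)
    | None, Some v => Some (fy - v)
    | None, None => None
    end in
  if answer is Some a then
    let H := (st_hard s).+1 in
    if H%:R > hard_query_bound n alpha t
    then (None, PmwgState true (Some t) y H run2)
    else
      let r := if a < fy then f else const_mx 1 - f in
      (Some a, PmwgState false (Some t) (mw_update alpha y r) H run2)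
  else (Some fy, PmwgState false (Some t) y (st_hard s) run2).

Definition pmwg_step (n : nat) (alpha : R) (xi : nat -> R) w
    (F : query_strategy R N) (X : nat -> 'rV[R]_N)
    (hs : seq (option R) * pmwg_state) : seq (option R) * pmwg_state :=
  let: (h, s) := hs in
  if st_done s then (rcons h None, s) else
  if F h is Some (t, f) then
    let: (o, s') := pmwg_query n alpha xi w (size h) t f (X t) s in
    (rcons h o, s')
  else (rcons h None,
        PmwgState true (st_last s) (st_hist s) (st_hard s) (st_nsg s)).

Definition pmwg (n : nat) (alpha : R) (xi : nat -> R) w
    (F : query_strategy R N) (X : nat -> 'rV[R]_N) : transcript R :=
  fun k => nth None (iter k.+1 (pmwg_step n alpha xi w F X)
                       ([::], pmwg_init)).1 k.

End pmwg.
Arguments bt {R} N t.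

(* (eps,0)-differential privacy of a randomized algorithm mapping database
   streams, started at size n, to transcripts; [A X] is its transcript as a
   function of the sample point. *)
Definition differentially_private (R : realType) (N n : nat)
    (d : measure_display) (Omega : measurableType d) (P : probability Omega R)
    (A : (nat -> 'rV[R]_N) -> Omega -> transcript R) (eps : R) : Prop :=
  forall X X' : nat -> 'rV[R]_N,
    is_database_stream n X -> is_database_stream n X' ->
    neighboring_streams n X X' ->
  forall S : set (transcript R), transcript_measurable S ->
    (P (A X @^-1` S) <= (expR eps)%:E * P (A X' @^-1` S))%E.

Definition pmwg_noise (R : realType) (N n : nat) (alpha eps0 : R) (t : nat) : R :=
  alpha ^+ 2 * Num.sqrt n%:R / (162 * ln (N * n)%:R) * eps0 * Num.sqrt t%:R.

(* Main.v *)
Require Import Defs.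
From HB Require Import structures.
From mathcomp Require Import all_boot all_order all_algebra.
From mathcomp Require Import all_classical all_reals all_analysis.
From mathcomp Require Import measurable_realfun ring lra.

(** The noise is moved so that an execution on one stream becomes an execution on
its neighbor with the same transcript.  Write s_t = xi_t / t, which is
nonincreasing, and let an NATG instance be started at time t_0 and halt at time
t_1.  Shifting eta by s_(t_0) keeps all answers bot (cost s_(t_0) / 2), shifting
the last nu by s_(t_0) / xi_(t_1) + 1 / t_1 keeps the positive answer (cost
(s_(t_0) + s_(t_1)) / 4), and shifting Z by at most 1 / t_1 keeps its value (cost
s_(t_1) / 8), in total at most 3/4 s_(t_0) + 3/8 s_(t_1).  If both g_1 and g_2 are
answered, the second instance is free: as g_2 = - g_1, a change of the database
that makes one of the two comparisons harder makes the other one easier.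

The instance following a hard query at time t starts at time at least t, so the
hard queries at times tau_1 <= tau_2 <= ... cost at most 9/8 times the sum of the
s_(tau_i), plus 3/4 s_n for the first instance and 1/4 s_n if PMWG halts.  As the
i-th hard query satisfies i <= 36/alpha^2 (log N + sum_(n < tau <= tau_i) b_tau),
summation by parts bounds the sum of the s_(tau_i).

The shifts depend on earlier outputs, hence are made one query at a time, along
hybrid executions that answer the first j queries from the second stream.  They
are carried out separately for each of the countably many sequences of arrival
times and positive answers, which yields the bound for events depending on
finitely many outputs; the monotone class theorem gives the rest. *)

Set Implicit Arguments.
Unset Strict Implicit.
Unset Printing Implicit Defensive.

Import Order.TTheory GRing.Theory Num.Theory.
Import numFieldNormedType.Exports.

Local Open Scope classical_set_scope.
Local Open Scope ring_scope.

(** * Translations of Laplace noise *)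

Section laplace_shift.
Context {R : realType}.
Local Notation mu := (@lebesgue_measure R).

Lemma measurable_addr (c : R) : measurable_fun [set: R] (fun z : R => z + c).
Proof. exact: measurable_funD. Qed.

Definition translate (c : R) (z : measurableTypeR R) : measurableTypeR R :=
  z + c.

Lemma measurable_translate (c : R) : measurable_fun [set: _] (translate c).
Proof. exact: measurable_addr. Qed.

HB.instance Definition _ (c : R) :=
  isMeasurableFun.Build _ _ _ _ (translate c) (measurable_translate c).

(** Half-open intervals keep their length under translation, and their lengths determine the
    measure. *)
Lemma lebesgue_measure_translate (c : R) (A : set R) : measurable A ->
  pushforward mu (translate c) A = mu A.
Proof.
move=> mA; apply/esym/lebesgue_measure_unique => //= _ [[a b]] _ <-.
have -> : pushforward mu (translate c) `]a, b]%classic =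
          mu `]a - c, b - c]%classic.
  rewrite /pushforward; congr (mu _); apply/seteqP; split => x /=;
  by rewrite !in_itv/= ltrBlDr lerBrDr.
rewrite !lebesgue_measure_itv/= !lte_fin ltrD2r; case: ifP => // _.
by rewrite -!EFinB; congr EFin; ring.
Qed.

Lemma measurable_laplace_pdf (b : R) : measurable_fun [set: R] (laplace_pdf b).
Proof.
apply: measurable_funM => //; apply: measurableT_comp => //.
by apply: measurable_funM => //; exact: measurableT_comp.
Qed.

Lemma laplace_pdf_ge0 (b z : R) : 0 < b -> 0 <= laplace_pdf b z.
Proof. by move=> b0; rewrite mulr_ge0 ?expR_ge0// invr_ge0 mulr_ge0// ltW. Qed.

Lemma laplace_pdf_shift (b c z : R) : 0 < b ->
  laplace_pdf b z <= expR (`|c| / b) * laplace_pdf b (z + c).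
Proof.
move=> b0; rewrite /laplace_pdf mulrCA; apply: ler_wpM2l.
  by rewrite invr_ge0 mulr_ge0// ltW.
rewrite -expRD ler_expR -mulrDl ler_pM2r ?invr_gt0//.
by have := ler_normD z c; lra.
Qed.

Variables (D : probability R R) (b : R).
Hypothesis b0 : 0 < b.
Hypothesis DE : forall A : set R, measurable A ->
  D A = (\int[mu]_(z in A) (laplace_pdf b z)%:E)%E.

(** The preimage is [A + c]. By translation invariance its mass is the integral over [A] of the
    density at [z + c], to which [laplace_pdf_shift] compares the density at [z]. *)
Lemma laplace_measure_shift (c : R) (A : set R) : measurable A ->
  (D A <= (expR (`|c| / b))%:E * D ((fun z : R => (z - c)%R) @^-1` A))%E.
Proof.
move=> mA.
have mA' : measurable ((fun z : R => (z - c)%R) @^-1` A).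
  by rewrite -[X in measurable X]setTI; exact: measurable_addr.
rewrite !DE//.
have mp := @measurable_laplace_pdf b.
have <- : (\int[pushforward mu (translate c)]_(z in
      (fun z : R => (z - c)%R) @^-1` A) (laplace_pdf b z)%:E =
    \int[mu]_(z in (fun z : R => (z - c)%R) @^-1` A) (laplace_pdf b z)%:E)%E.
  by apply: eq_measure_integral => B mB _; exact: lebesgue_measure_translate.
rewrite ge0_integral_pushforward//; first last.
- by move=> z _; rewrite lee_fin laplace_pdf_ge0.
- by apply/measurable_EFinP; exact: measurable_funTS.
have -> : translate c @^-1` ((fun z : R => (z - c)%R) @^-1` A) = A.
  by apply/seteqP; split => x /=; rewrite /translate addrK.
have mpc : measurable_fun [set: R] (fun z : R => laplace_pdf b (z + c)).
  exact: measurableT_comp mp (measurable_addr c).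
rewrite -ge0_integralZl//; first last.
- by move=> z _; rewrite lee_fin laplace_pdf_ge0.
- by apply/measurable_EFinP; apply: measurable_funTS.
apply: ge0_le_integral => //.
- by move=> z _; rewrite lee_fin laplace_pdf_ge0.
- by apply/measurable_EFinP; exact: measurable_funTS.
- apply: measurable_funTS; apply/measurable_EFinP.
  exact: measurable_funM.
- by move=> z _; rewrite -EFinM lee_fin laplace_pdf_shift.
Qed.

Lemma laplace_integral_shift (c : R) (G G' : R -> \bar R) :
  measurable_fun [set: R] G -> measurable_fun [set: R] G' ->
  (forall z, 0 <= G z)%E -> (forall z, 0 <= G' z)%E ->
  (forall z, G z <= G' (z + c)%R)%E ->
  (\int[D]_z G z <= (expR (`|c| / b))%:E * \int[D]_z G' z)%E.
Proof.
move=> mG mG' G0 G'0 GG'.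
pose phi : {mfun R >-> R} :=
  HB.pack (fun z : R => z - c : R)
    (isMeasurableFun.Build _ _ _ _ _ (measurable_addr (- c))).
pose k : {nonneg R} := NngNum (expR_ge0 (`|c| / b)).
(* As measures [D <= m2], and integrating [G] against [m2] amounts to integrating [G (z - c)]
   against [k * D]. *)
pose m2 := mscale k (distribution D phi).
have Dm2 : (\int[D]_z G z <= \int[m2]_z G z)%E.
  by apply: ge0_le_measure_integral => // A mA; exact: laplace_measure_shift.
apply: (le_trans Dm2).
rewrite ge0_integral_mscale//= ge0_integral_distribution//=.
apply: lee_pmul => //.
- by apply: integral_ge0 => // z _.
- apply: ge0_le_integral => //; last first.
    by move=> z _ /=; rewrite (le_trans (GG' _))// subrK.
  exact: measurableT_comp mG (measurable_addr (- c)).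
Qed.

End laplace_shift.

(** * Independent families of draws *)

Section image_measure.
Context d1 d2 (T1 : measurableType d1) (T2 : measurableType d2) (R : realType).
Variables (m : {measure set T1 -> \bar R}) (f : {mfun T1 >-> T2}).

Definition image_measure : set T2 -> \bar R := pushforward m f.

Let image_measure0 : image_measure set0 = 0%E.
Proof. exact: measure0. Qed.

Let image_measure_ge0 A : (0 <= image_measure A)%E.
Proof. exact: measure_ge0. Qed.

Let image_measure_sigma_additive : semi_sigma_additive image_measure.
Proof. exact: measure_semi_sigma_additive. Qed.

HB.instance Definition _ := isMeasure.Build _ _ _ image_measure
  image_measure0 image_measure_ge0 image_measure_sigma_additive.

End image_measure.

Section noise_space.
Context {R : realType} {I : eqType}.

Definition coord_cylinders : set (set (I -> R)) :=
  [set A | exists e (B : set R), measurable B /\ A = [set u | B (u e)]].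

(** The product sigma-algebra: all draws together form one random element of this space, whose
    coordinates can be integrated out one at a time. *)
Definition noise_space := g_sigma_algebraType coord_cylinders.

HB.instance Definition _ := Measurable.on noise_space.

Definition upd (u : noise_space) (e : I) (z : R) : noise_space :=
  fun e' => if e' == e then z else u e'.

Lemma measurable_cylinder e (B : set R) : measurable B ->
  measurable [set u : noise_space | B (u e)].
Proof. by move=> mB; apply: sub_sigma_algebra; exists e, B. Qed.

Lemma measurable_coord e : measurable_fun [set: noise_space] (fun u => u e).
Proof. by move=> _ B mB; rewrite setTI; exact: measurable_cylinder. Qed.

Lemma measurable_to_noise d (T : measurableType d) (f : T -> noise_space) :
  (forall e, measurable_fun [set: T] (fun x => f x e)) ->
  measurable_fun [set: T] f.
Proof.
move=> mf; apply: (@measurability _ _ T noise_space setT f coord_cylinders) => //.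
by move=> _ [_ [e [B [mB ->]]] <-]; exact: mf.
Qed.

Definition resample (e : I) (x : noise_space * R) : noise_space :=
  upd x.1 e x.2.

Lemma measurable_resample e : measurable_fun [set: _] (resample e).
Proof.
apply: measurable_to_noise => e'; rewrite /resample /upd; case: (e' == e).
  exact: measurable_snd.
exact: (@measurableT_comp _ _ _ _ _ _ (fun u : noise_space => u e') setT fst
  (measurable_coord e') measurable_fst).
Qed.

HB.instance Definition _ e := isMeasurableFun.Build _ _ _ _
  (resample e) (measurable_resample e).

(** The family [B] is total and equals [setT] off the finite list [s], so that boxes with different
    lists intersect coordinatewise. *)
Definition boxes : set (set noise_space) :=
  [set A | exists (s : seq I) (B : I -> set R),
    [/\ forall e, measurable (B e), forall e, e \notin s -> B e = setT &
        A = [set u | forall e, B e (u e)]]].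

Lemma measurable_boxes : boxes `<=` @measurable _ noise_space.
Proof.
move=> _ [s [B [mB Bs ->]]].
have -> : [set u : noise_space | forall e, B e (u e)] =
    \bigcap_(e in [set` s]) [set u | B e (u e)].
  apply/seteqP; split => u /= Bu; first by move=> e _; exact: Bu.
  by move=> e; have [/Bu//|/Bs ->] := boolP (e \in s).
by apply: fin_bigcap_measurable => // e _; exact: measurable_cylinder.
Qed.

Lemma sigma_boxes : @measurable _ noise_space = <<s boxes >>.
Proof.
apply/seteqP; split; last first.
  apply: smallest_sub; first exact: sigma_algebra_measurable.
  exact: measurable_boxes.
apply: sub_sigma_algebra2 => _ [e [B [mB ->]]].
exists [:: e], (fun e' => if e' == e then B else setT); split.
- by move=> e'; case: ifP.
- by move=> e'; rewrite inE => /negbTE ->.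
- apply/seteqP; split => u /=; first by move=> Bu e'; case: eqP => // ->.
  by move=> /(_ e); rewrite eqxx.
Qed.

Lemma setI_boxes : setI_closed boxes.
Proof.
move=> _ _ [s [B [mB Bs ->]]] [s' [B' [mB' Bs' ->]]].
exists (s ++ s'), (fun e => B e `&` B' e); split.
- by move=> e; exact: measurableI.
- by move=> e; rewrite mem_cat negb_or => /andP[/Bs -> /Bs' ->]; rewrite setTI.
- apply/seteqP; split => u /=; first by move=> [Bu Bu'] e; split.
  by move=> BB; split=> e; case: (BB e).
Qed.

Context {d : measure_display} {Omega : measurableType d}.
Variables (P : probability Omega R) (W : I -> {RV P >-> R}).
Hypothesis indepW : mutually_independent W.

Definition noise (x : Omega) : noise_space := fun e => W e x.

Lemma measurable_noise : measurable_fun [set: Omega] noise.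
Proof. by apply: measurable_to_noise => e; exact: measurable_funP. Qed.

HB.instance Definition _ := isMeasurableFun.Build _ _ _ _
  noise measurable_noise.

Definition law : probability noise_space R := distribution P noise.

(** Independence is assumed for injectively indexed draws, whence the [undup]. *)
Lemma law_box (s : seq I) (B : I -> set R) : (forall e, measurable (B e)) ->
  (forall e, e \notin s -> B e = setT) ->
  law [set u | forall e, B e (u e)] =
  (\prod_(e <- undup s) P (W e @^-1` B e))%E.
Proof.
move=> mB Bs; rewrite big_tnth -indepW//; last first.
  by apply/tuple_uniqP; exact: undup_uniq.
congr (P _); apply/seteqP; split => x /= Bx.
  by move=> j _; exact: Bx.
move=> e; have [es|/Bs ->//] := boolP (e \in s).
have /tnthP[j ej] : e \in in_tuple (undup s) by rewrite mem_undup.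
by rewrite ej; exact: Bx.
Qed.

(** Both sides agree on the boxes, a generating family closed under intersection. This is the form
    in which independence is used: any single draw may be redrawn. *)
Lemma law_resample e (A : set noise_space) : measurable A ->
  law A = image_measure (law \x distribution P (W e))%E
            (resample e) A.
Proof.
apply: (measure_unique boxes (fun=> setT)) => //.
- exact: sigma_boxes.
- exact: setI_boxes.
- by move=> _; exists [::], (fun=> setT); split=> //; apply/seteqP; split.
- by rewrite bigcup_const.
- move=> _ [s [B [mB Bs ->]]].
  pose B' e' := if e' == e then setT else B e'.
  have mB' e' : measurable (B' e') by rewrite /B'; case: ifP.
  transitivity ((law \x distribution P (W e))%E
      ([set u : noise_space | forall e', B' e' (u e')] `*` B e)); last first.
    congr (_ _); apply/seteqP; split => -[u z] /=; rewrite /resample/=.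
      move=> [Bu Bz] e'; rewrite /upd; case: (eqVneq e' e) => [->//|ee'].
      by move: (Bu e'); rewrite /B' (negbTE ee').
    move=> Bu; split; last by move: (Bu e); rewrite /upd eqxx.
    by move=> e'; move: (Bu e'); rewrite /upd /B'; case: eqP.
  (* Both boxes are seen over the list [e :: s], so that the factor at [e] can be split off; for
     [B'] it is 1. *)
  have sB e' : e' \notin e :: s -> B e' = setT.
    by rewrite inE negb_or => /andP[_ /Bs].
  have sB' e' : e' \notin e :: s -> B' e' = setT.
    by rewrite /B'; case: eqP => // _; exact: sB.
  have mbB' : measurable [set u : noise_space | forall e', B' e' (u e')].
    by apply: measurable_boxes; exists (e :: s), B'.
  apply: (etrans (law_box mB sB)).
  apply: (etrans _ (esym (product_measure1E _ _ mbB' (mB e)))).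
  transitivity (law [set u : noise_space | forall e', B' e' (u e')] *
    P (W e @^-1` B e))%E; last by [].
  rewrite (law_box mB' sB').
  have es : e \in undup (e :: s) by rewrite mem_undup mem_head.
  rewrite !(bigD1_seq e es (undup_uniq _))/=.
  have -> : B' e = setT by rewrite /B' eqxx.
  rewrite preimage_setT probability_setT mul1e muleC; congr (_ * _)%E.
  by apply: eq_bigr => e' /negbTE ee'; rewrite /B' ee'.
- by move=> _; apply: (le_lt_trans (probability_le1 _ _)); rewrite ?ltry.
Qed.

Lemma law_fubini e (phi : noise_space -> \bar R) :
  measurable_fun [set: noise_space] phi -> (forall u, 0 <= phi u)%E ->
  (\int[law]_u phi u =
   \int[law]_u \int[distribution P (W e)]_z phi (upd u e z))%E.
Proof.
move=> mphi phi0.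
transitivity (\int[image_measure (law \x distribution P (W e))%E
  (resample e)]_u phi u)%E.
  by apply: eq_measure_integral => A mA _; exact: law_resample.
rewrite ge0_integral_pushforward//.
rewrite fubini_tonelli1//=.
exact: measurableT_comp mphi (measurable_resample e).
Qed.

End noise_space.

(** * Translations of finitely many independent draws *)

Section noise_shift.
Context {R : realType} {I : eqType}.
Context {d : measure_display} {Omega : measurableType d}.
Variables (P : probability Omega R) (W : I -> {RV P >-> R}).
Hypothesis indepW : mutually_independent W.
Local Notation noise_space := (@noise_space R I).

Definition shift_coords (es : seq I) (c : I -> R) (u : noise_space) : noise_space :=
  fun e => if e \in es then u e + c e else u e.

(** For independent draws this is the conditional expectation of [phi] given the coordinates outside
    [es]. *)
Fixpoint iter_integral (es : seq I) (phi : noise_space -> \bar R)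
    (u : noise_space) : \bar R :=
  if es is e :: es' then
    (\int[distribution P (W e)]_z iter_integral es' phi (upd u e z))%E
  else phi u.

Lemma iter_integral_ge0 es phi u : (forall u, 0 <= phi u)%E ->
  (0 <= iter_integral es phi u)%E.
Proof.
move=> phi0; elim: es u => [|e es IH] u //=.
by apply: integral_ge0 => z _; exact: IH.
Qed.

Lemma measurable_iter_integral es phi :
  measurable_fun [set: noise_space] phi -> (forall u, 0 <= phi u)%E ->
  measurable_fun [set: noise_space] (iter_integral es phi).
Proof.
move=> mphi phi0; elim: es => [//|e es IH] /=.
apply: (@measurable_fun_fubini_tonelli_F _ _ _ _ _ _
  (fun x : noise_space * R => iter_integral es phi (upd x.1 e x.2))).
- exact: measurableT_comp IH (measurable_resample e).
- by move=> x; exact: iter_integral_ge0.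
Qed.

Lemma measurable_iter_integral_upd es phi u e :
  measurable_fun [set: noise_space] phi -> (forall u, 0 <= phi u)%E ->
  measurable_fun [set: R] (fun z => iter_integral es phi (upd u e z)).
Proof.
move=> mphi phi0; apply: (measurableT_comp (measurable_iter_integral _ mphi phi0)).
by apply: measurable_to_noise => e'; rewrite /upd; case: eqP.
Qed.

Lemma integral_iter_integral es phi :
  measurable_fun [set: noise_space] phi -> (forall u, 0 <= phi u)%E ->
  (\int[law W]_u iter_integral es phi u = \int[law W]_u phi u)%E.
Proof.
move=> mphi phi0; elim: es => [//|e es IH] /=; rewrite -IH.
rewrite [in RHS](law_fubini indepW e)//; first exact: measurable_iter_integral.
by move=> u; exact: iter_integral_ge0.
Qed.

Lemma iter_integral_shift1 es phi e (c : R) u : e \notin es ->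
  iter_integral es (fun v => phi (upd v e (v e + c))) u =
  iter_integral es phi (upd u e (u e + c)).
Proof.
elim: es u => [//|e1 es IH] u; rewrite inE negb_or => /andP[ee1 ees] /=.
apply: eq_integral => z _; rewrite IH//; congr iter_integral.
apply/funext => e'; rewrite /upd (negbTE ee1).
by case: (eqVneq e' e) => [->|//]; rewrite (negbTE ee1).
Qed.

Variable b : I -> R.

(** Induction on [es]: the outermost integral costs [|c e| / b e] by [laplace_integral_shift], and
    the inner ones are handled by the induction hypothesis for [psi] composed with the translation
    of the coordinate [e]. *)
Lemma iter_integral_shift es phi psi (c : I -> R) u : uniq es ->
  (forall e, e \in es -> 0 < b e /\ laplace_distributed (W e) (b e)) ->
  measurable_fun [set: noise_space] phi -> (forall u, 0 <= phi u)%E ->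
  measurable_fun [set: noise_space] psi -> (forall u, 0 <= psi u)%E ->
  (forall v : noise_space, (forall e, e \notin es -> v e = u e) ->
     (phi v <= psi (shift_coords es c v))%E) ->
  (iter_integral es phi u <=
   (expR (\sum_(e <- es) `|c e| / b e))%:E * iter_integral es psi u)%E.
Proof.
move=> + + mphi phi0.
elim: es psi u => [|e es IH] psi u /=.
  move=> _ _ _ _ H; rewrite big_nil expR0 mul1e.
  have -> : psi u = psi (shift_coords [::] c u) by [].
  exact: H.
move=> /andP[ees ues] Lap mpsi psi0 H.
have [b0 LW] := Lap e (mem_head _ _).
rewrite big_cons expRD EFinM -muleA.
set K := expR (\sum_(e <- es) _).
have K0 : (0 <= K%:E)%E by rewrite lee_fin expR_ge0.
rewrite -ge0_integralZl//; first last.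
- by move=> z _; exact: iter_integral_ge0.
- exact: measurable_iter_integral_upd.
have mup : measurable_fun [set: noise_space]
    (fun v : noise_space => upd v e (v e + c e)).
  apply: measurable_to_noise => e'; rewrite /upd; case: eqP => _.
    by apply: measurable_funD => //; exact: measurable_coord.
  exact: measurable_coord.
apply: laplace_integral_shift => //.
- exact: measurable_iter_integral_upd.
- by apply: emeasurable_funM => //; exact: measurable_iter_integral_upd.
- by move=> z; exact: iter_integral_ge0.
- by move=> z; rewrite mule_ge0//; exact: iter_integral_ge0.
- move=> z; apply: le_trans (IH (fun v => psi (upd v e (v e + c e))) _ _ _ _ _ _) _ => //.
  + by move=> e' e's; apply: Lap; rewrite inE e's orbT.
  + exact: measurableT_comp mpsi mup.
  + move=> v Hv; apply: le_trans (H v _) _.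
      move=> e'; rewrite inE negb_or => /andP[e'e /Hv ->].
      by rewrite /upd (negbTE e'e).
    rewrite le_eqVlt; apply/orP; left; apply/eqP; congr psi.
    apply/funext => e'; rewrite /shift_coords /upd inE.
    by case: (eqVneq e' e) => [->|//]; rewrite (negbTE ees).
  + rewrite iter_integral_shift1//.
    have -> : upd (upd u e z) e (upd u e z e + c e) = upd u e (z + c e) :> noise_space.
      by apply/funext => e'; rewrite /upd eqxx; case: eqP.
    by [].
Qed.

(* The shift [c u] is the same on the whole fibre of [u] over the coordinates
   outside [es], so that it acts there as a translation. *)
Lemma law_shift es (c : noise_space -> I -> R) (A B : set noise_space) (C : R) :
  uniq es ->
  (forall e, e \in es -> 0 < b e /\ laplace_distributed (W e) (b e)) ->
  measurable A -> measurable B ->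
  (forall u v : noise_space, (forall e, e \notin es -> v e = u e) -> c v = c u) ->
  (forall u, \sum_(e <- es) `|c u e| / b e <= C) ->
  (forall u, A u -> B (shift_coords es (c u) u)) ->
  (law W A <= (expR C)%:E * law W B)%E.
Proof.
move=> ues Lap mA mB cE cC AB.
have mind D : measurable D ->
    measurable_fun [set: noise_space] (fun u => (\1_D u)%:E : \bar R).
  by move=> mD; apply/measurable_EFinP; exact: measurable_indic.
have ind0 D (u : noise_space) : (0 <= (\1_D u)%:E :> \bar R)%E by rewrite lee_fin.
have lawE D : measurable D ->
    law W D = (\int[law W]_u iter_integral es (fun u => (\1_D u)%:E) u)%E.
  by move=> mD; rewrite integral_iter_integral ?integral_indic ?setIT//; exact: mind.
rewrite !lawE// -ge0_integralZl//; first last.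
- by move=> u _; exact: iter_integral_ge0.
- by apply: measurable_iter_integral => //; exact: mind.
apply: ge0_le_integral => //.
- by move=> u _; exact: iter_integral_ge0.
- by apply: measurable_iter_integral => //; exact: mind.
- apply: emeasurable_funM => //.
  by apply: measurable_iter_integral => //; exact: mind.
- move=> u _.
  apply: (@le_trans _ _ ((expR (\sum_(e <- es) `|c u e| / b e))%:E *
      iter_integral es (fun u => (\1_B u)%:E) u)%E).
    apply: iter_integral_shift => //; [exact: mind|exact: mind|].
    move=> v vu; rewrite lee_fin -(cE _ _ vu) !indicE.
    have [/set_mem/AB/mem_set ->|_] := boolP (v \in A); first by [].
    by rewrite ler0n.
  apply: lee_wpmul2r; first exact: iter_integral_ge0.
  by rewrite lee_fin ler_expR.
Qed.

End noise_shift.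

(** * Countable case distinctions *)

Section countable.
Context {R : realType} {d : measure_display} {T : measurableType d}.

Lemma measurable_prop (p : Prop) : measurable [set _ : T | p].
Proof.
have [pP|np] := pselect p.
  by rewrite (_ : [set _ | _] = setT)//; apply/seteqP; split.
by rewrite (_ : [set _ | _] = set0)//; apply/seteqP; split.
Qed.

Lemma measurable_select (I : countType) (f : T -> I) (A : I -> set T) :
  (forall i, measurable [set u | f u = i]) ->
  (forall i, measurable ([set u | f u = i] `&` A i)) ->
  measurable [set u | A (f u) u].
Proof.
move=> mf mA.
have -> : [set u | A (f u) u] =
    \bigcup_(n in setT) (if unpickle n is Some i then [set u | f u = i] `&` A i else set0).
  apply/seteqP; split => u /=.
    by move=> Au; exists (pickle (f u)) => //; rewrite pickleK.
  by case=> n _; case: unpickle => // i [/= <-].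
by apply: bigcup_measurable => n _; case: unpickle.
Qed.

Lemma countable_le_measure (I : countType) (m : {measure set T -> \bar R})
    (f g : T -> I) (A B : set T) (k : R) :
  measurable A -> measurable B ->
  (forall i, measurable [set u | f u = i]) ->
  (forall i, measurable [set u | g u = i]) ->
  (forall i, (m ([set u | f u = i] `&` A) <= k%:E * m ([set u | g u = i] `&` B))%E) ->
  (m A <= k%:E * m B)%E.
Proof.
move=> mA mB mf mg le.
(* Several [n] may unpickle to the same [i]; the condition [pickle i = n] keeps the pieces
   disjoint. *)
pose piece (h : T -> I) D n :=
  if unpickle n is Some i then [set u | h u = i /\ pickle i = n] `&` D else set0.
have mpiece h D n : measurable D -> (forall i, measurable [set u | h u = i]) ->
    measurable (piece h D n).
  move=> mD mh; rewrite /piece; case: unpickle => // i.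
  apply: measurableI => //; have [->|ne] := eqVneq (pickle i) n.
    by rewrite (_ : [set u | _] = [set u | h u = i])//; apply/seteqP; split => u /= => [[]|].
  rewrite (_ : [set u | _] = set0)//; apply/seteqP; split => u //= [_ /eqP].
  by rewrite (negbTE ne).
have mE h D : measurable D -> (forall i, measurable [set u | h u = i]) ->
    m D = (\sum_(n <oo) m (piece h D n))%E.
  move=> mD mh; have {1}-> : D = \bigcup_n piece h D n.
    apply/seteqP; split => u.
      by move=> Du; exists (pickle (h u)) => //; rewrite /piece pickleK.
    by move=> [n _]; rewrite /piece; case: unpickle => // i [].
  rewrite measure_bigcup//; first by apply: eq_eseriesl => n; rewrite in_setT.
    by move=> n _; exact: mpiece.
  apply/trivIsetP => n n' _ _ nn'; apply/seteqP; split => u //= -[].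
  rewrite /piece; case: (unpickle n) => // i [[hi pi] _].
  case: (unpickle n') => // i' [[hi' pi'] _].
  by move: nn'; rewrite -pi -pi' -hi -hi' eqxx.
rewrite (mE f A)// (mE g B)// -nneseriesZl//.
apply: lee_nneseries => // n _.
rewrite /piece; case: unpickle => [i|]; last by rewrite !measure0 mule0.
have [<-|ne] := eqVneq (pickle i) n.
  have E (h : T -> I) : [set u | h u = i /\ pickle i = pickle i] = [set u | h u = i].
    by apply/seteqP; split => u /= => [[]|].
  by rewrite !E.
have E (h : T -> I) : [set u | h u = i /\ pickle i = n] = set0.
  by apply/seteqP; split => u //= [_ /eqP]; rewrite (negbTE ne).
by rewrite !E !set0I !measure0 mule0.
Qed.

End countable.

(** * Measures on transcripts *)

Section transcript_measures.
Context {R : realType} {d : measure_display} {T : measurableType d}.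

Definition cylinders_below (K : nat) : set (set (transcript R)) :=
  [set A | exists k (B : set R), [/\ (k < K)%N, measurable B &
     A = [set tau : transcript R | exists2 r, tau k = Some r & B r]]].

Lemma measurable_preimage_transcript (G : set (set (transcript R)))
    (Y : T -> transcript R) (S : set (transcript R)) :
  (forall A, G A -> measurable (Y @^-1` A)) -> <<s G >> S ->
  measurable (Y @^-1` S).
Proof.
move=> mY; apply: (smallest_sub (C := sigma_algebra setT)
  (X := [set S | measurable (Y @^-1` S)])) => //.
split=> /=.
- by rewrite preimage_set0.
- by move=> A mA; rewrite setTD preimage_setC; exact: measurableC.
- by move=> A mA; rewrite preimage_bigcup; exact: bigcupT_measurable.
Qed.

(** The sets that do not separate [tau] from [tau'] form a sigma-algebra containing the cylinders
    below [K]. *)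
Lemma cylinders_below_local K (S : set (transcript R)) (tau tau' : transcript R) :
  <<s cylinders_below K >> S -> (forall k, (k < K)%N -> tau k = tau' k) ->
  S tau <-> S tau'.
Proof.
move=> + tautau'; pose G := [set S : set (transcript R) | S tau <-> S tau'].
apply: (smallest_sub (C := sigma_algebra setT) (X := G)) => //.
- split=> /=.
  + by [].
  + by move=> A AE; rewrite /G/=; split=> -[_ nA]; split => // /AE.
  + by move=> A AE; split=> -[i _ Ai]; exists i => //; apply/AE.
- by move=> _ [k [B [kK mB ->]]]; rewrite /G/= tautau'.
Qed.

(** The sigma-algebras increase with [K], so finitely many sets lie in a common one. *)
Lemma setring_cylinders_below :
  setring [set S | exists K, <<s cylinders_below K >> S].
Proof.
have mono K K' : (K <= K')%N ->
    <<s cylinders_below K >> `<=` <<s cylinders_below K' >>.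
  move=> KK'; apply: sub_sigma_algebra2 => _ [k [B [kK mB ->]]].
  by exists k, B; split=> //; exact: leq_trans KK'.
have U : setU_closed [set S | exists K, <<s cylinders_below K >> S].
  move=> A B [K KA] [K' KB]; exists (maxn K K').
  rewrite -bigcup2E; apply: sigma_algebra_bigcup => -[|[|i]] /=.
  - exact: mono (leq_maxl _ _) _ KA.
  - exact: mono (leq_maxr _ _) _ KB.
  - exact: sigma_algebra0.
have closC A : (exists K, <<s cylinders_below K >> A) ->
    exists K, <<s cylinders_below K >> (~` A).
  by move=> [K KA]; exists K; rewrite -setTD; exact: sigma_algebraCD.
split=> //.
- by exists 0%N; exact: sigma_algebra0.
- move=> A B KA KB; rewrite setDE -[A]setCK -setCU.
  by apply: (closC); apply: U => //; exact: closC.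
Qed.

(** Monotone class argument: by continuity of [m] the inequality survives increasing unions and
    decreasing intersections. *)
Lemma transcript_measure_le (m : probability T R) (Y Y' : T -> transcript R)
    (k : R) :
  (forall A, transcript_cylinders A -> measurable (Y @^-1` A)) ->
  (forall A, transcript_cylinders A -> measurable (Y' @^-1` A)) ->
  (forall K S, <<s cylinders_below K >> S ->
     (m (Y @^-1` S) <= k%:E * m (Y' @^-1` S))%E) ->
  forall S, transcript_measurable S ->
    (m (Y @^-1` S) <= k%:E * m (Y' @^-1` S))%E.
Proof.
move=> mY mY' le S mS.
pose G := [set S | exists K, <<s cylinders_below K >> S].
pose M := [set S | [/\ measurable (Y @^-1` S), measurable (Y' @^-1` S) &
  (m (Y @^-1` S) <= k%:E * m (Y' @^-1` S))%E]].
suff : M S by case.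
have GM : G `<=` M.
  move=> A [K KA]; split; last exact: le KA.
  - apply: measurable_preimage_transcript KA => _ [i [B [_ mB ->]]].
    by apply: mY; exists i, B.
  - apply: measurable_preimage_transcript KA => _ [i [B [_ mB ->]]].
    by apply: mY'; exists i, B.
have limle (A A' : (set T)^nat) (B B' : set T) :
    m \o A @ \oo --> m B -> m \o A' @ \oo --> m B' ->
    (forall i, (m (A i) <= k%:E * m (A' i))%E) -> (m B <= k%:E * m B')%E.
  move=> AB AB' AA'.
  have kAB' : (fun i => k%:E * m (A' i))%E @ \oo --> (k%:E * m B')%E by exact: cvgeZl.
  rewrite -(cvg_lim _ AB)// -(cvg_lim _ kAB')//.
  apply: lee_lim; [by apply/cvg_ex; exists (m B)| |exact: nearW].
  by apply/cvg_ex; eexists; exact: kAB'.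
(* Continuity from above starts from a set of finite measure. *)
have fin A : (m A < +oo)%E \/ ~ measurable A.
  have [mA|] := pselect (measurable A); last by right.
  by left; apply: (le_lt_trans (probability_le1 _ mA)); rewrite ltry.
have monoM : monotone M.
  split=> A mA MA.
  - have ndp (Z : T -> transcript R) : nondecreasing_seq (fun i => Z @^-1` A i).
      move=> i j ij; apply/subsetPset; apply: preimage_subset.
      by apply/subsetPset; exact: mA.
    have m1 : measurable (Y @^-1` (\bigcup_i A i)).
      by rewrite preimage_bigcup; apply: bigcupT_measurable => i; case: (MA i).
    have m2 : measurable (Y' @^-1` (\bigcup_i A i)).
      by rewrite preimage_bigcup; apply: bigcupT_measurable => i; case: (MA i).
    split=> //.
    rewrite !preimage_bigcup in m1 m2 *.
    apply: (limle (fun i => Y @^-1` A i) (fun i => Y' @^-1` A i)).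
    + by apply: nondecreasing_cvg_mu => // i; case: (MA i).
    + by apply: nondecreasing_cvg_mu => // i; case: (MA i).
    + by move=> i; case: (MA i).
  - have nip (Z : T -> transcript R) : nonincreasing_seq (fun i => Z @^-1` A i).
      move=> i j ij; apply/subsetPset; apply: preimage_subset.
      by apply/subsetPset; exact: mA.
    have m1 : measurable (Y @^-1` (\bigcap_i A i)).
      by rewrite preimage_bigcap; apply: bigcapT_measurable => i; case: (MA i).
    have m2 : measurable (Y' @^-1` (\bigcap_i A i)).
      by rewrite preimage_bigcap; apply: bigcapT_measurable => i; case: (MA i).
    split=> //.
    rewrite !preimage_bigcap in m1 m2 *.
    apply: (limle (fun i => Y @^-1` A i) (fun i => Y' @^-1` A i)).
    + apply: nonincreasing_cvg_mu => //; last by move=> i; case: (MA i).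
      by case: (fin (Y @^-1` A 0%N)) => // -[]; case: (MA 0%N).
    + apply: nonincreasing_cvg_mu => //; last by move=> i; case: (MA i).
      by case: (fin (Y' @^-1` A 0%N)) => // -[]; case: (MA 0%N).
    + by move=> i; case: (MA i).
apply: (monotone_setring_sub_g_sigma_ring monoM setring_cylinders_below GM).
(* The sigma-ring generated by [G] contains [setT], because [G] does; it is therefore a
   sigma-algebra, and it contains all cylinders. *)
have [sr0 srD srU] := smallest_sigma_ring G.
move: mS; apply: smallest_sub => /=.
- split=> //; move=> A mA; apply: srD => //; apply: sub_g_sigma_ring.
  by exists 0%N; rewrite -[X in _ X]setD0; apply: sigma_algebraCD; exact: sigma_algebra0.
- move=> A [i [B [mB ->]]]; apply: sub_g_sigma_ring.
  by exists i.+1; apply: sub_sigma_algebra; exists i, B; split.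
Qed.

End transcript_measures.

(** * Labelled executions *)

HB.instance Definition _ := gen_eqMixin draw.

Section run.
Context {R : realType} {N : nat}.
Variables (n : nat) (alpha : R) (xi : nat -> R) (F : query_strategy R N).
Local Notation noise_space := (@noise_space R draw).
Local Notation state := (@pmwg_state R N).
Local Notation T := (2 * alpha / 3).
Implicit Types (u : noise_space) (f x y : 'rV[R]_N).

Definition fire1 u k t f x y (r : option R) : bool :=
  T + odflt (u (Eta k false)) r / xi t <=
    qeval f x - qeval f y + u (Nu t k false).

(** An answer to [g_1] halts its instance, so [g_2] meets a new one with its own draw; otherwise
    both queries go to the same instance. *)
Definition eta2 u k (b1 : bool) (r : option R) : R :=
  if b1 then u (Eta k true) else odflt (u (Eta k false)) r.

Definition fire2 u k t f x y b1 (r : option R) : bool :=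
  T + eta2 u k b1 r / xi t <= qeval f y - qeval f x + u (Nu t k true).

(** The estimate [f(y)] cancels, so an answer depends only on the database and on Z. The value
    matters only if some query is answered. *)
Definition answer u k t f x (b1 : bool) : R :=
  if b1 then qeval f x + u (Zeta t k false) else qeval f x - u (Zeta t k true).

(** The rest of the processing, isolated because the current database enters it only through [b1],
    [b2] and [a]. *)
Definition query_result t f y (H : nat) (b1 b2 : bool) (a eta : R) :
    option R * state :=
  let run := if b2 then None else Some eta in
  if b1 || b2 then
    if hard_query_bound (N := N) n alpha t < H.+1%:R
    then (None, PmwgState true (Some t) y H.+1 run)
    else (Some a, PmwgState false (Some t)
            (mw_update alpha y (if a < qeval f y then f else const_mx 1 - f))
            H.+1 run)
  else (Some (qeval f y), PmwgState false (Some t) y H run).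

Lemma pmwg_queryE u k t f x (s : state) :
  let y := mix_uniform (st_last s) t (st_hist s) in
  let b1 := fire1 u k t f x y (st_nsg s) in
  let b2 := fire2 u k t f x y b1 (st_nsg s) in
  pmwg_query n alpha xi u k t f x s =
  query_result t f y (st_hard s) b1 b2 (answer u k t f x b1)
    (eta2 u k b1 (st_nsg s)).
Proof.
rewrite /pmwg_query /nsg /natg /query_result /fire2 /fire1 /answer /eta2 /=.
set y := mix_uniform _ _ _; set b1 := (_ <= _).
have e1 v : qeval f y + (qeval f x - qeval f y + v) = qeval f x + v by ring.
have e2 v : qeval f y - (qeval f y - qeval f x + v) = qeval f x - v by ring.
by case: b1 => /=; set b2 := (_ <= _); case: b2 => /=; rewrite ?e1 ?e2.
Qed.

(* A label records the arrival time of a query, whether g_1 is answered,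
   whether g_2 is answered without PMWG halting, and whether PMWG halts.  The
   answer to g_2 must stay unrecorded when PMWG halts: keeping it the same for
   both databases would cost more than the privacy budget allows. *)
Definition label := option (nat * (bool * bool * bool)).

Record run := Run {
  run_hist : seq (option R);
  run_state : state;
  run_path : seq label
}.

Definition run_init := Run [::] pmwg_init [::].

Definition run_step (X : nat -> 'rV[R]_N) u (r : run) : run :=
  let: Run h s p := r in
  if st_done s then Run (rcons h None) s (rcons p None) else
  if F h is Some (t, f) then
    let k := size h in
    let y := mix_uniform (st_last s) t (st_hist s) in
    let b1 := fire1 u k t f (X t) y (st_nsg s) in
    let b2 := fire2 u k t f (X t) y b1 (st_nsg s) in
    let: (o, s') := query_result t f y (st_hard s) b1 b2
      (answer u k t f (X t) b1) (eta2 u k b1 (st_nsg s)) in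
    Run (rcons h o) s'
      (rcons p (Some (t, (b1, b2 && ~~ st_done s', st_done s'))))
  else Run (rcons h None)
         (PmwgState true (st_last s) (st_hist s) (st_hard s) (st_nsg s))
         (rcons p None).

Lemma run_step_pmwg X u r :
  (run_hist (run_step X u r), run_state (run_step X u r)) =
  pmwg_step n alpha xi u F X (run_hist r, run_state r).
Proof.
case: r => h s p /=; case: ifP => // _; case: (F h) => [[t f]|]//.
by rewrite pmwg_queryE; case: query_result.
Qed.

Lemma iter_run_step_pmwg X u k :
  (run_hist (iter k (run_step X u) run_init),
   run_state (iter k (run_step X u) run_init)) =
  iter k (pmwg_step n alpha xi u F X) ([::], pmwg_init).
Proof. by elim: k => [//|k IH]; rewrite !iterS run_step_pmwg IH. Qed.

Lemma run_hist_step X u r : exists o,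
  run_hist (run_step X u r) = rcons (run_hist r) o.
Proof.
case: r => h s p /=; case: ifP => _; first by eexists.
case: (F h) => [[t f]|]; last by eexists.
by case: query_result => o s'; exists o.
Qed.

Lemma size_run_hist X u k r :
  size (run_hist (iter k (run_step X u) r)) = (k + size (run_hist r))%N.
Proof.
elim: k => [//|k IH] /=; have [v ->] := run_hist_step X u (iter k (run_step X u) r).
by rewrite size_rcons IH.
Qed.

Lemma run_path_step X u r : exists l,
  run_path (run_step X u r) = rcons (run_path r) l.
Proof.
case: r => h s p /=; case: ifP => _; first by eexists.
case: (F h) => [[t f]|]; last by eexists.
by case: query_result => o s'; eexists.
Qed.

Lemma run_path_iter X u k r : exists2 p,
  run_path (iter k (run_step X u) r) = run_path r ++ p & size p = k.
Proof.
elim: k => [|k [p IH sp]]; first by exists [::] => //; rewrite cats0.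
rewrite iterS; have [l ->] := run_path_step X u (iter k (run_step X u) r).
by exists (rcons p l); rewrite ?size_rcons ?sp// IH -rcons_cat.
Qed.

Lemma nth_run_hist X u k K : (k < K)%N ->
  nth None (run_hist (iter K (run_step X u) run_init)) k =
  pmwg n alpha xi u F X k.
Proof.
elim: K => [//|K IH]; rewrite ltnS leq_eqVlt => /predU1P[->|kK].
  by rewrite /pmwg -iter_run_step_pmwg.
rewrite -(IH kK) iterS.
have [v ->] := run_hist_step X u (iter K (run_step X u) run_init).
by rewrite nth_rcons size_run_hist addn0 kK.
Qed.

(** These observations stand in for a sigma-algebra on the record [run]: equality for discrete
    components, Borel sets for real ones. *)
Inductive run_event : set run -> Prop :=
| HistEvent k (B : set R) of measurable B : run_event
    [set r | exists2 z, nth None (run_hist r) k = Some z & B z]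
| DoneEvent b : run_event [set r | st_done (run_state r) = b]
| LastEvent l : run_event [set r | st_last (run_state r) = l]
| HardEvent H : run_event [set r | st_hard (run_state r) = H]
| PublicEvent j (B : set R) of measurable B : run_event
    [set r | B (st_hist (run_state r) ord0 j)]
| NsgEvent (B : set R) of measurable B : run_event
    [set r | exists2 z, st_nsg (run_state r) = Some z & B z]
| PathEvent p : run_event [set r | run_path r = p].

(** The history has the constant length [k], so that the next query has a fixed index and [F] sees a
    prefix of fixed length, as in [is_query_stream]. *)
Definition measurable_run (k : nat) (phi : noise_space -> run) : Prop :=
  (forall u, size (run_hist (phi u)) = k) /\
  (forall Q, run_event Q -> measurable (phi @^-1` Q)).

Definition measurable_opt (o : noise_space -> option R) : Prop :=
  forall B : set R, measurable B -> measurable [set u | exists2 z, o u = Some z & B z].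

(** Discrete components may thus be treated as constants, in countably many cases. *)
Lemma measurable_run_glue (I : countType) (g : noise_space -> I) k phi psi :
  (forall i, measurable [set u | g u = i]) ->
  (forall i, measurable_run k (psi i)) -> (forall u, phi u = psi (g u) u) ->
  measurable_run k phi.
Proof.
move=> mg mpsi phiE; split; first by move=> u; rewrite phiE; case: (mpsi (g u)).
move=> Q QE.
rewrite (_ : _ @^-1` _ = [set u | (psi (g u) @^-1` Q) u]); last first.
  by apply/seteqP; split => u /=; rewrite phiE.
apply: (measurable_select (A := fun i => psi i @^-1` Q)) => // i.
by apply: measurableI => //; apply: (mpsi i).2.
Qed.

Lemma measurable_run_rcons k phi dn l H (o run : noise_space -> option R)
    (y : noise_space -> 'rV[R]_N) (lab : label) :
  measurable_run k phi -> measurable_opt o -> measurable_opt run ->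
  (forall j, measurable_fun [set: noise_space] (fun u => y u ord0 j)) ->
  measurable_run k.+1 (fun u => Run (rcons (run_hist (phi u)) (o u))
    (PmwgState dn l (y u) H (run u)) (rcons (run_path (phi u)) lab)).
Proof.
move=> [sphi mphi] mo mrun my; split; first by move=> u /=; rewrite size_rcons sphi.
move=> _ [i B mB|b|l'|H'|j B mB|B mB|p]; rewrite /preimage /=; try exact: measurable_prop.
- have [ik|ki|->] := ltngtP i k.
  + rewrite (_ : [set _ | _] = [set u |
        exists2 z, nth None (run_hist (phi u)) i = Some z & B z]).
      exact: (mphi _ (HistEvent i mB)).
    by apply/seteqP; split => u /=; rewrite nth_rcons sphi ik.
  + rewrite (_ : [set _ | _] = set0)//; apply/seteqP; split => u //= -[z].
    by rewrite nth_rcons sphi ltnNge (ltnW ki) gtn_eqF.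
  + rewrite (_ : [set _ | _] = [set u | exists2 z, o u = Some z & B z]); first exact: mo.
    by apply/seteqP; split => u /=; rewrite nth_rcons sphi ltnn eqxx.
- by rewrite -[X in measurable X]setTI; exact: my.
- exact: mrun.
- case: (lastP p) => [|p' lab'].
    rewrite (_ : [set _ | _] = set0)//; apply/seteqP; split => u //=.
    by move=> /(congr1 size); rewrite size_rcons.
  have [<-|ne] := eqVneq lab lab'.
    rewrite (_ : [set _ | _] = [set u | run_path (phi u) = p']).
      exact: (mphi _ (PathEvent p')).
    by apply/seteqP; split => u /= => [/rcons_inj[]|->].
  rewrite (_ : [set _ | _] = set0)//; apply/seteqP; split => u //=.
  by move=> /rcons_inj[_ /eqP]; rewrite (negbTE ne).
Qed.

End run.

(** * Measurability of one step of the execution *)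

Section measurable_step.
Context {R : realType} {N : nat}.
Variables (n : nat) (alpha : R) (xi : nat -> R) (F : query_strategy R N).
Hypothesis N_gt0 : (0 < N)%N.
Hypothesis F_stream : is_query_stream n F.
Local Notation noise_space := (@noise_space R draw).
Local Notation mfun g := (measurable_fun [set: noise_space] g).
Implicit Types (u : noise_space) (X : nat -> 'rV[R]_N).

(** Inversion is discontinuous at 0; on either side it is expressed through [ln] and [expR]. *)
Lemma measurable_inv : measurable_fun [set: R] (fun z : R => z^-1).
Proof.
rewrite (_ : (fun z => z^-1) = (fun z => if 0 < z then expR (- ln z) else
    if z < 0 then - expR (- ln (- z)) else 0)); last first.
  apply/funext => z; case: ltgtP => [z0|z0|<-]; last by rewrite invr0.
  - by rewrite expRN lnK.
  - by rewrite expRN lnK ?posrE ?oppr_gt0// invrN opprK.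
have mln : measurable_fun [set: R] (@ln R) by exact: measurable_ln.
apply: measurable_fun_ifT; first exact: measurable_fun_ltr.
  by apply: measurableT_comp => //; exact: measurableT_comp.
apply: measurable_fun_ifT => //; first exact: measurable_fun_ltr.
apply: measurableT_comp => //; apply: measurableT_comp => //.
by apply: measurableT_comp => //; exact: measurableT_comp.
Qed.

Lemma measurable_qeval (f : noise_space -> 'rV[R]_N) (x : noise_space -> 'rV[R]_N) :
  (forall j, mfun (fun u => f u ord0 j)) ->
  (forall j, mfun (fun u => x u ord0 j)) -> mfun (fun u => qeval (f u) (x u)).
Proof.
by move=> mf mx; apply: measurable_sum => j; exact: measurable_funM.
Qed.

Lemma measurable_mw_update (y r : noise_space -> 'rV[R]_N) :
  (forall j, mfun (fun u => y u ord0 j)) ->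
  (forall j, mfun (fun u => r u ord0 j)) ->
  forall j, mfun (fun u => mw_update alpha (y u) (r u) ord0 j).
Proof.
move=> my mr j; rewrite /mw_update.
have mu i : mfun (fun u => y u ord0 i * expR (- alpha * r u ord0 i / 6)).
  apply: measurable_funM => //; apply: measurableT_comp => //.
  by apply: measurable_funM => //; exact: measurable_funM.
apply: (eq_measurable_fun (fun u => y u ord0 j * expR (- alpha * r u ord0 j / 6) /
    \sum_i y u ord0 i * expR (- alpha * r u ord0 i / 6))).
  by move=> u _; rewrite mxE.
apply: measurable_funM => //; apply: (measurableT_comp measurable_inv).
exact: measurable_sum.
Qed.

Lemma measurable_mix_uniform l t (y : noise_space -> 'rV[R]_N) :
  (forall j, mfun (fun u => y u ord0 j)) ->
  forall j, mfun (fun u => mix_uniform l t (y u) ord0 j).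
Proof.
move=> my j; rewrite /mix_uniform; case: l => [t'|]//; case: (t' < t)%N => //.
apply: (eq_measurable_fun (fun u => t'%:R / t%:R * y u ord0 j +
    (t - t')%:R / t%:R * N%:R^-1)); first by move=> u _; rewrite mxE.
by apply: measurable_funD => //; exact: measurable_funM.
Qed.

Lemma measurable_bool_fiber (g : noise_space -> bool) b : mfun g ->
  measurable [set u | g u = b].
Proof.
by move=> mg; rewrite -[X in measurable X]setTI; exact: (mg measurableT [set b]).
Qed.

Lemma measurable_query_result k (phi : noise_space -> @run R N) t H
    (f y : noise_space -> 'rV[R]_N)
    (b1 b2 : noise_space -> bool) (a eta : noise_space -> R) :
  measurable_run k phi ->
  (forall j, mfun (fun u => f u ord0 j)) ->
  (forall j, mfun (fun u => y u ord0 j)) ->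
  mfun b1 -> mfun b2 -> mfun a -> mfun eta ->
  measurable_run k.+1 (fun u =>
    let: (o, s') := query_result n alpha t (f u) (y u) H (b1 u) (b2 u) (a u) (eta u) in
    Run (rcons (run_hist (phi u)) o) s' (rcons (run_path (phi u))
      (Some (t, (b1 u, b2 u && ~~ st_done s', st_done s'))))).
Proof.
move=> mphi mf my mb1 mb2 ma meta.
have mopt_cst : measurable_opt (fun=> None : option R).
  by move=> B _; rewrite (_ : [set _ | _] = set0)//; apply/seteqP; split => u // -[].
have mopt_some (g : noise_space -> R) : mfun g -> measurable_opt (fun u => Some (g u)).
  move=> mg B mB; rewrite (_ : [set _ | _] = [set u | B (g u)]).
    by rewrite -[X in measurable X]setTI; exact: mg.
  by apply/seteqP; split => u /= => [[z [->]]|]//; exists (g u).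
have mfy : mfun (fun u => qeval (f u) (y u)) by exact: measurable_qeval.
have mlt : mfun (fun u => a u < qeval (f u) (y u)) by exact: measurable_fun_ltr.
(* Once the two comparisons and the sign selecting the multiplicative update are fixed, no branching
   on the noise remains. *)
apply: (measurable_run_glue (g := fun u => (b1 u, b2 u, a u < qeval (f u) (y u)))
  (psi := fun i u => let: (c1, c2, c3) := i in
    let run := if c2 then None else Some (eta u) in
    if c1 || c2 then
      if hard_query_bound (N := N) n alpha t < H.+1%:R
      then Run (rcons (run_hist (phi u)) None) (PmwgState true (Some t) (y u) H.+1 run)
        (rcons (run_path (phi u)) (Some (t, (c1, false, true))))
      else Run (rcons (run_hist (phi u)) (Some (a u))) (PmwgState false (Some t)
            (mw_update alpha (y u) (if c3 then f u else const_mx 1 - f u))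
            H.+1 run) (rcons (run_path (phi u)) (Some (t, (c1, c2, false))))
    else Run (rcons (run_hist (phi u)) (Some (qeval (f u) (y u))))
           (PmwgState false (Some t) (y u) H run)
           (rcons (run_path (phi u)) (Some (t, (c1, c2, false)))))).
- move=> [[c1 c2] c3].
  rewrite (_ : [set _ | _] = [set u | b1 u = c1] `&` [set u | b2 u = c2] `&`
    [set u | (a u < qeval (f u) (y u)) = c3]); last first.
    by apply/seteqP; split => u /= => [[-> -> ->]|[[-> ->] ->]].
  by apply: measurableI; [apply: measurableI|]; exact: measurable_bool_fiber.
- move=> [[c1 c2] c3] /=.
  have mrun : measurable_opt (fun u => if c2 then None else Some (eta u)).
    by case: c2 => //; exact: mopt_some.
  case: (c1 || c2); last by apply: measurable_run_rcons => //; exact: mopt_some.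
  case: (_ < _); apply: measurable_run_rcons => //; first exact: mopt_some.
  apply: measurable_mw_update => // j; case: c3 => //.
  apply: (eq_measurable_fun (fun u => 1 - f u ord0 j)); last exact: measurable_funB.
  by move=> u _; rewrite !mxE.
- move=> u; rewrite /query_result.
  case: (b1 u) (b2 u) => -[]//=; case: ifP => _ //=; rewrite ?andbT ?andbF //.
Qed.

Lemma measurable_run_step X k phi : measurable_run k phi ->
  measurable_run k.+1 (fun u => run_step n alpha xi F X u (phi u)).
Proof.
move=> mphi; have [sphi mev] := mphi.
have [_ _ _ _ F_meas] := F_stream.
(* The next query is split into its arrival time, which is discrete, and its vector, set to 0 when
   no query is left. *)
pose Ft u := omap fst (F (run_hist (phi u))).
pose Fq u := if F (run_hist (phi u)) is Some (_, f) then f else 0.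
have mF t (i : 'I_N) (B : set R) : measurable B ->
    measurable [set u | exists2 f, F (run_hist (phi u)) = Some (t, f) & B (f ord0 i)].
  move=> mB; have := F_meas k t i B mB.
  move=> /(measurable_preimage_transcript (Y := fun u => nth None (run_hist (phi u)))).
  rewrite /preimage/= (_ : [set _ | _] =
    [set u | exists2 f, F (run_hist (phi u)) = Some (t, f) & B (f ord0 i)]); last first.
    by apply/seteqP; split => u /=; rewrite -(sphi u) mkseq_nth.
  by apply=> _ [i' [B' [mB' ->]]]; exact: (mev _ (HistEvent i' mB')).
have mFtS t : measurable [set u | Ft u = Some t].
  (* The measurability of [F] is stated coordinatewise; any coordinate expresses that a query
     arrives at time [t], and one exists as [N > 0]. *)
  rewrite (_ : [set _ | _] = [set u | exists2 f, F (run_hist (phi u)) = Some (t, f) &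
     [set: R] (f ord0 (Ordinal N_gt0))]); first exact: mF.
  apply/seteqP; split => u /=; rewrite /Ft.
    by case: (F _) => [[t' f]|]//= [->]; exists f.
  by case=> f ->.
have mFt i : measurable [set u | Ft u = i].
  case: i => [t|]; first exact: mFtS.
  rewrite (_ : [set _ | _] = ~` \bigcup_(t in setT) [set u | Ft u = Some t]); last first.
    apply/seteqP; split => u /=; first by move=> E [t _] /=; rewrite E.
    by case E: (Ft u) => [t|]// []; exists t.
  by apply: measurableC; apply: bigcup_measurable.
have mFq j : mfun (fun u => Fq u ord0 j).
  move=> _ B mB; rewrite setTI.
  pose AF i := if i is Some t then
      [set u | exists2 f, F (run_hist (phi u)) = Some (t, f) & B (f ord0 j)]
      else [set u | B 0].
  rewrite (_ : _ @^-1` _ = [set u | AF (Ft u) u]); last first.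
    apply/seteqP; split => u /=; rewrite /AF /Ft /Fq.
      by case E: (F (run_hist (phi u))) => [[t f]|] /=; [exists f|rewrite mxE].
    case E: (F (run_hist (phi u))) => [[t f]|] /=; last by rewrite mxE.
    by case=> f'; rewrite E => -[<-].
  apply: (measurable_select (A := AF)) => // -[t|]; apply: measurableI => //; first exact: mF.
  exact: measurable_prop.
pose rf u := isSome (st_nsg (run_state (phi u))).
pose eta0 u := odflt 0 (st_nsg (run_state (phi u))).
have mrfT : measurable [set u | rf u = true].
  rewrite (_ : [set _ | _] = [set u |
    exists2 z, st_nsg (run_state (phi u)) = Some z & [set: R] z]).
    exact: (mev _ (NsgEvent measurableT)).
  apply/seteqP; split => u /=; rewrite /rf; last by case=> z ->.
  by case: (st_nsg _) => [z|]// _; exists z.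
have mrf b : measurable [set u | rf u = b].
  case: b => //; rewrite (_ : [set _ | _] = ~` [set u | rf u = true]).
    exact: measurableC.
  by apply/seteqP; split => u /=; case: (rf u).
have meta0 : mfun eta0.
  move=> _ B mB; rewrite setTI.
  pose AF (b : bool) := if b then
      [set u | exists2 z, st_nsg (run_state (phi u)) = Some z & B z]
      else [set u | B 0].
  rewrite (_ : _ @^-1` _ = [set u | AF (rf u) u]); last first.
    apply/seteqP; split => u /=; rewrite /AF /rf /eta0.
      by case E: (st_nsg (run_state (phi u))) => [z|] //=; exists z.
    case E: (st_nsg (run_state (phi u))) => [z|] //=.
    by case=> z'; rewrite E => -[<-].
  apply: (measurable_select (A := AF)) => // -[]; apply: measurableI => //.
    exact: (mev _ (NsgEvent mB)).
  exact: measurable_prop.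
have my j : mfun (fun u => st_hist (run_state (phi u)) ord0 j).
  by move=> _ B mB; rewrite setTI; exact: (mev _ (PublicEvent j mB)).
have mopt_none : measurable_opt (fun=> None : option R).
  by move=> B _; rewrite (_ : [set _ | _] = set0)//; apply/seteqP; split => u // -[].
have mopt_nsg : measurable_opt (fun u => st_nsg (run_state (phi u))).
  by move=> B mB; exact: (mev _ (NsgEvent mB)).
pose yy l t u := mix_uniform l t (st_hist (run_state (phi u))).
pose rr (c : bool) u := if c then Some (eta0 u) else None.
pose B1 l c t u := fire1 alpha xi u k t (Fq u) (X t) (yy l t u) (rr c u).
pose B2 l c t u := fire2 alpha xi u k t (Fq u) (X t) (yy l t u) (B1 l c t u) (rr c u).
pose I : countType := (bool * option nat * nat * bool * option nat)%type.
pose g u : I := (st_done (run_state (phi u)), st_last (run_state (phi u)),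
     st_hard (run_state (phi u)), rf u, Ft u).
pose psi (i : I) u : @run R N := let: (dn, l, H, c, ot) := i in
    if dn then Run (rcons (run_hist (phi u)) None)
      (PmwgState true l (st_hist (run_state (phi u))) H (st_nsg (run_state (phi u))))
      (rcons (run_path (phi u)) None)
    else if ot is Some t then
      let: (o, s') := query_result n alpha t (Fq u) (yy l t u) H (B1 l c t u) (B2 l c t u)
        (answer u k t (Fq u) (X t) (B1 l c t u)) (eta2 u k (B1 l c t u) (rr c u)) in
      Run (rcons (run_hist (phi u)) o) s' (rcons (run_path (phi u))
        (Some (t, (B1 l c t u, B2 l c t u && ~~ st_done s', st_done s'))))
    else Run (rcons (run_hist (phi u)) None)
      (PmwgState true l (st_hist (run_state (phi u))) H (st_nsg (run_state (phi u))))
      (rcons (run_path (phi u)) None).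
apply: (measurable_run_glue (g := g) (psi := psi)).
- move=> [[[[dn l] H] c] ot].
  rewrite (_ : [set _ | _] = [set u | st_done (run_state (phi u)) = dn] `&`
    [set u | st_last (run_state (phi u)) = l] `&`
    [set u | st_hard (run_state (phi u)) = H] `&` [set u | rf u = c] `&` [set u | Ft u = ot]).
    by do 4?[apply: measurableI => //]; [exact: (mev _ (DoneEvent _))|
      exact: (mev _ (LastEvent _))|exact: (mev _ (HardEvent _))].
  by apply/seteqP; split => u /=; rewrite /g;
    [move=> [-> -> -> -> ->]|move=> [[[[-> ->] ->] ->] ->]].
- move=> [[[[dn l] H] c] ot]; case: dn; first exact: measurable_run_rcons.
  case: ot => [t|]; last exact: measurable_run_rcons.
  have mcoord e : mfun (fun u => u e) by exact: measurable_coord.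
  have myy j : mfun (fun u => yy l t u ord0 j) by exact: measurable_mix_uniform.
  have mqy : mfun (fun u => qeval (Fq u) (yy l t u)) by exact: measurable_qeval.
  have mqx : mfun (fun u => qeval (Fq u) (X t)) by exact: measurable_qeval.
  have meta1 : mfun (fun u => odflt (u (Eta k false)) (rr c u)).
    by rewrite /rr; case: c => /=; [exact: meta0|exact: mcoord].
  have mB1 : mfun (B1 l c t).
    by apply: measurable_fun_ler; apply: measurable_funD => //;
      [exact: measurable_funM|exact: measurable_funB].
  have meta2 : mfun (fun u => eta2 u k (B1 l c t u) (rr c u)).
    exact: measurable_fun_ifT.
  have mB2 : mfun (B2 l c t).
    by apply: measurable_fun_ler; apply: measurable_funD => //;
      [exact: measurable_funM|exact: measurable_funB].
  apply: measurable_query_result => //.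
  by apply: measurable_fun_ifT => //; [exact: measurable_funD|exact: measurable_funB].
- move=> u; have := sphi u; rewrite /psi /g /B2 /B1 /Ft /Fq /yy /rr /rf /eta0.
  case: (phi u) => h [dn l y H nsg] p /= <-; case: dn => //.
  by case: (F h) => [[t f]|]//=; case: nsg.
Qed.

End measurable_step.

(** * Shifts of the draws of one query *)

Section coupling.
Context {R : realType} {N : nat}.
Variables (n : nat) (alpha : R) (xi : nat -> R) (F : query_strategy R N).
Local Notation noise_space := (@noise_space R draw).
Local Notation run_step := (run_step n alpha xi F).
Local Notation s t := (xi t / t%:R).

(* The part of the execution that is determined by the labels: the hard-query
   count, the time of the last hard query ([n] if there is none), and the time at
   which the running NATG instance was started. *)
Record ghost := Ghost {
  g_hard : nat;
  g_mark : nat;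
  g_start : option nat
}.

Definition ghost_init := Ghost 0 n None.

(** When a hard query does not halt PMWG and [b2] is false, [g_1] was answered, and the instance
    then started for [g_2] keeps running. *)
Definition ghost_step (g : ghost) (l : label) : ghost :=
  if l is Some (t, (b1, b2, dn)) then
    if [|| b1, b2 | dn]
    then Ghost (g_hard g).+1 t (if b2 then None else Some t)
    else Ghost (g_hard g) (g_mark g) (Some (odflt t (g_start g)))
  else g.

Definition ghost_of (p : seq label) : ghost := foldl ghost_step ghost_init p.

Lemma ghost_of_rcons p l : ghost_of (rcons p l) = ghost_step (ghost_of p) l.
Proof. exact: foldl_rcons. Qed.

(** The excess of the running draw eta in the execution on the second database over that on the
    first. *)
Definition eta_shift (g : ghost) : R :=
  if g_start g is Some t then s t else 0.

(** The scales of eta, nu and Z are 2, [4 / xi t] and [8 / xi t]. The first summand pays for the eta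
    of an instance started for [g_1]; the second for nu, and for Z unless PMWG halts, with 3/8 = 1/4
    + 1/8; the third for the eta of an instance that starts at [g_2] and keeps running. *)
Definition label_cost (g : ghost) (l : label) : R :=
  if l is Some (t, (b1, b2, dn)) then
    (if g_start g is Some _ then 0 else s t / 2) +
    (if [|| b1, b2 | dn]
     then s (odflt t (g_start g)) / 4 + (if dn then s t / 4 else 3 / 8 * s t)
     else 0) +
    (if [&& b1, ~~ b2 & ~~ dn] then s t / 2 else 0)
  else 0.

Definition path_cost (p : seq label) : R :=
  \sum_(j < size p) label_cost (ghost_of (take j p)) (nth None p j).

Lemma path_cost_rcons p l :
  path_cost (rcons p l) = path_cost p + label_cost (ghost_of p) l.
Proof.
rewrite /path_cost size_rcons big_ord_recr/= nth_rcons ltnn eqxx.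
rewrite -cats1 takel_cat// take_size; congr (_ + _); apply: eq_bigr => j _.
by rewrite takel_cat ?(ltnW (ltn_ord j))// nth_cat ltn_ord.
Qed.

(* Shifts turning an execution on the first database into one on its neighbor
   with the same label [(t, (b1, b2, dn))]; [del] is the difference of the query
   values, and [sg] the shift of the draw eta used for g_1. *)
Definition draw_shift (start : option nat) (t : nat) (b1 b2 dn : bool) (del : R)
    (e : draw) : R :=
  let sg := s (odflt t start) in
  match e with
  | Eta _ false => if isSome start then 0 else s t
  | Eta _ true => if [&& b1, ~~ b2 & ~~ dn] then s t else 0
  | Nu _ _ false => if b1 then sg / xi t + Num.max 0 (- del) else 0
  | Nu _ _ true =>
      if b1 then if b2 then Num.max 0 del else 0
      else if b2 || dn then sg / xi t + Num.max 0 del else 0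
  | Zeta _ _ false => if b1 && ~~ dn then - del else 0
  | Zeta _ _ true => if ~~ b1 && b2 then del else 0
  end.

Definition step_draws (k t : nat) : seq draw :=
  [:: Eta k false; Eta k true; Nu t k false; Nu t k true;
      Zeta t k false; Zeta t k true].

Definition draw_index (e : draw) : nat :=
  match e with Eta k _ | Nu _ k _ | Zeta _ k _ => k end.

Lemma step_draws_index k t e : e \in step_draws k t -> draw_index e = k.
Proof. by rewrite !inE => /or4P[| | |/or3P[]] /eqP ->. Qed.

Lemma uniq_step_draws k t : uniq (step_draws k t).
Proof.
pose code e := match e with
  | Eta _ b => (0%N, b) | Nu _ _ b => (1%N, b) | Zeta _ _ b => (2%N, b) end.
exact: (@map_uniq _ _ code).
Qed.

(** The positive parts of [- del] and [del] add up to [|del|], so shifting nu for both queries stays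
    within the bound for one. *)
Lemma draw_shift_cost g k t b1 b2 dn del : 0 < xi t ->
  (0 < t)%N -> 0 <= s (odflt t (g_start g)) -> b2 && dn = false ->
  `|del| <= t%:R^-1 ->
  \sum_(e <- step_draws k t)
    `|draw_shift (g_start g) t b1 b2 dn del e| / draw_scale xi e <=
  label_cost g (Some (t, (b1, b2, dn))).
Proof.
move=> xi0 t0 sg0 b2dn del_le.
rewrite !big_cons big_nil /= /label_cost.
set sg := s (odflt t (g_start g)) in sg0 *.
set m1 := Num.max 0 (- del); set m2 := Num.max 0 del.
have xin0 : xi t != 0 by rewrite gt_eqF.
have dxi : `|del| * xi t <= s t by rewrite mulrC ler_pM2l.
have st0 : 0 <= s t by rewrite divr_ge0// ltW.
have m1_ge0 : 0 <= m1 by rewrite /m1 le_max lexx.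
have m2_ge0 : 0 <= m2 by rewrite /m2 le_max lexx.
have m12 : m1 + m2 = `|del|.
  case: (ger0P del) => d0.
    have -> : m1 = 0 by apply: max_l; rewrite oppr_le0.
    by rewrite add0r; exact: max_r.
  have -> : m2 = 0 by apply: max_l; exact: ltW.
  by rewrite addr0; apply: max_r; rewrite oppr_ge0 ltW.
have E4 x : x / (4 / xi t) = x * xi t / 4 by field.
have E8 x : x / (8 / xi t) = x * xi t / 8 by field.
have Esg m : (sg / xi t + m) * xi t = sg + m * xi t by field.
have nsg m : 0 <= m -> `|sg / xi t + m| = sg / xi t + m.
  by move=> m0; rewrite ger0_norm// addr_ge0// divr_ge0// ltW.
have x1 : 0 <= m1 * xi t by rewrite mulr_ge0// ltW.
have x2 : 0 <= m2 * xi t by rewrite mulr_ge0// ltW.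
have x12 : m1 * xi t + m2 * xi t <= s t by rewrite -mulrDl m12.
have x3 : 0 <= `|del| * xi t by rewrite mulr_ge0// ltW.
have nst : `|s t| = s t by rewrite ger0_norm.
have nm2 : `|m2| = m2 by rewrite ger0_norm.
move: b2dn; case: (g_start g) => [t'|]; case: b1; case: b2; case: dn => //= _;
  rewrite !E4 !E8 ?normr0 ?normrN ?nsg ?Esg ?nst ?nm2//; lra.
Qed.

(** Undoes the shift of the running draw eta, the only component in which coupled executions differ
    before halting. *)
Definition shift_nsg (c : R) (r : @run R N) : run :=
  let: Run h (PmwgState dn l y H ns) p := r in
  Run h (PmwgState dn l y H (omap (fun e => e - c) ns)) p.

(** After halting the state no longer affects the outputs, and the coupling does not control all of
    it; hence the condition on the last clause. *)
Definition same_run (r1 r2 : @run R N) : Prop :=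
  [/\ run_hist r1 = run_hist r2, run_path r1 = run_path r2,
      st_done (run_state r1) = st_done (run_state r2) &
      ~~ st_done (run_state r1) -> run_state r1 = run_state r2].

Lemma run_step_draws X (u v : noise_space) r :
  (forall e, draw_index e = size (run_hist r) -> u e = v e) ->
  run_step X u r = run_step X v r.
Proof.
case: r => h st p /= uv; case: ifP => // _; case: (F h) => [[t f]|]//.
by rewrite /fire2 /fire1 /answer /eta2 !uv.
Qed.

Lemma iter_run_step_draws X (u v : noise_space) j :
  (forall e, (draw_index e < j)%N -> u e = v e) ->
  iter j (run_step X u) run_init = iter j (run_step X v) run_init.
Proof.
elim: j => [//|j IH] uv; rewrite !iterS IH; last first.
  by move=> e ej; apply: uv; rewrite ltnS ltnW.
apply: run_step_draws => e; rewrite size_run_hist addn0 => ej.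
by apply: uv; rewrite ej.
Qed.

Lemma same_run_iter X (u v : noise_space) r1 r2 i : same_run r1 r2 ->
  (forall e, (size (run_hist r1) <= draw_index e)%N -> u e = v e) ->
  same_run (iter i (run_step X u) r1) (iter i (run_step X v) r2).
Proof.
move=> r12 uv; elim: i => [//|i]; rewrite !iterS.
have sz := size_run_hist n alpha xi F X u i r1.
case: (iter i (run_step X u) r1) (iter i (run_step X v) r2) sz => h1 s1 p1 [h2 s2 p2] sz.
case=> hh pp dd ss; rewrite /= in hh pp dd ss; subst h2 p2.
have [D|D] := boolP (st_done s1).
  have D2 : st_done s2 by rewrite -dd.
  by rewrite /= D D2; split => //=; rewrite D.
have {}ss := ss D; subst s2.
have -> : run_step X v (Run h1 s1 p1) = run_step X u (Run h1 s1 p1).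
  by apply: run_step_draws => e /= ek; rewrite uv// ek sz leq_addl.
rewrite /= (negbTE D); case: (F h1) => [[t f]|]; last by split.
by case: query_result => v0 s'; split.
Qed.

End coupling.

(** * Coupling of one query on two databases *)

Section coupling_step.
Context {R : realType} {N : nat}.
Variables (n : nat) (alpha : R) (xi : nat -> R) (F : query_strategy R N).
Hypothesis xi_gt0 : forall t, (0 < t)%N -> 0 < xi t.
Hypothesis s_noninc : forall t t', (0 < t)%N -> (t <= t')%N ->
  xi t' / t'%:R <= xi t / t%:R.
Local Notation noise_space := (@noise_space R draw).
Local Notation run_step := (run_step n alpha xi F).
Local Notation s t := (xi t / t%:R).
Local Notation eta_shift := (eta_shift xi).

(** Raising eta keeps bot answers, raising nu restores positive ones, and Z absorbs the change of
    the query value. The new ghost records the shift of eta that is carried to the next query. *)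
Lemma coupling_step (X X' : nat -> 'rV[R]_N) (u : noise_space) (r : @run R N)
    (g : ghost) (t : nat) (f : 'rV[R]_N) (b1 b2 dn : bool) :
  ~~ st_done (run_state r) -> F (run_hist r) = Some (t, f) ->
  isSome (g_start g) = isSome (st_nsg (run_state r)) ->
  (forall t0, g_start g = Some t0 -> (0 < t0 <= t)%N) -> (0 < t)%N ->
  `|qeval f (X' t) - qeval f (X t)| <= t%:R^-1 ->
  run_path (run_step X u (shift_nsg (eta_shift g) r)) =
    rcons (run_path r) (Some (t, (b1, b2, dn))) ->
  same_run (run_step X u (shift_nsg (eta_shift g) r))
    (shift_nsg (eta_shift (ghost_step g (Some (t, (b1, b2, dn)))))
      (run_step X'
        (shift_coords (step_draws (size (run_hist r)) t)
          (draw_shift xi (g_start g) t b1 b2 dn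
             (qeval f (X' t) - qeval f (X t))) u) r)).
Proof.
case: r => h [dn0 l y0 H ns] p; rewrite /= => /negbTE -> Fh nsE start_le t0.
rewrite Fh /=; set y := mix_uniform l t y0; set k := size h.
set del := qeval f (X' t) - qeval f (X t) => del_le.
have fx'E : qeval f (X' t) = qeval f (X t) + del by rewrite /del addrC subrK.
set sg := s (odflt t (g_start g)).
have xi0 := xi_gt0 t0.
have sg_ge : s t <= sg.
  rewrite /sg; case E : (g_start g) => [t1|//] /=.
  by have /andP[t10 t1t] := start_le _ E; exact: s_noninc.
(* The threshold rises by at least the sensitivity [1 / t], so bot stays bot; this is where [s] must
   be nonincreasing. *)
have D_ge : t%:R^-1 <= sg / xi t.
  by rewrite ler_pdivlMr// mulrC.
set ns1 := omap _ ns.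
set ES := (Y in shift_nsg Y _).
set c1 := fire1 alpha xi u k t f (X t) y ns1.
set c2 := fire2 alpha xi u k t f (X t) y c1 ns1.
move=> pathE.
have [b1E b2E dnE] : [/\ b1 = c1, b2 = c2 && ~~ dn &
    dn = (c1 || c2) && (hard_query_bound (N := N) n alpha t < H.+1%:R)].
  move: pathE; rewrite /query_result.
  by case: (c1 || c2) => /=; [case: ifP => _ /=|] => /rcons_inj[<- <- <-]; split.
clear pathE.
set v := shift_coords _ _ u.
have vE e : e \in step_draws k t ->
    v e = u e + draw_shift xi (g_start g) t b1 b2 dn del e.
  by rewrite /v /shift_coords => ->.
have vE1 : v (Eta k false) = u (Eta k false) + (if isSome (g_start g) then 0 else s t).
  by rewrite vE// !inE eqxx.
have vE2 : v (Eta k true) = u (Eta k true) + (if [&& b1, ~~ b2 & ~~ dn] then s t else 0).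
  by rewrite vE// !inE eqxx !orbT.
have vN1 : v (Nu t k false) = u (Nu t k false) +
    (if b1 then sg / xi t + Num.max 0 (- del) else 0).
  by rewrite vE// !inE eqxx !orbT.
have vN2 : v (Nu t k true) = u (Nu t k true) +
    (if b1 then if b2 then Num.max 0 del else 0
     else if b2 || dn then sg / xi t + Num.max 0 del else 0).
  by rewrite vE// !inE eqxx !orbT.
have vZ1 : v (Zeta t k false) = u (Zeta t k false) + (if b1 && ~~ dn then - del else 0).
  by rewrite vE// !inE eqxx !orbT.
have vZ2 : v (Zeta t k true) = u (Zeta t k true) + (if ~~ b1 && b2 then del else 0).
  by rewrite vE// !inE eqxx !orbT.
(* In a running instance the shift is already in the state; in a new one the draw itself is shifted
   by [s t]. *)
have eta1E : odflt (v (Eta k false)) ns = odflt (u (Eta k false)) ns1 + sg.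
  have etaS (a : R) (w : option R) : isSome (g_start g) = isSome w ->
      odflt (a + (if isSome (g_start g) then 0 else s t)) w =
      odflt a (omap (fun e => e - eta_shift g) w) + sg.
    rewrite /sg /(eta_shift _).
    by case: w => [z|] /=; case: (g_start g) => [t1|]//= _; rewrite subrK.
  by rewrite vE1 etaS.
have m1 : 0 <= Num.max 0 (- del) by rewrite le_max lexx.
have m1' : - del <= Num.max 0 (- del) by rewrite le_max lexx orbT.
have m2 : 0 <= Num.max 0 del by rewrite le_max lexx.
have m2' : del <= Num.max 0 del by rewrite le_max lexx orbT.
have /andP[del_ge {}del_le] : - t%:R^-1 <= del <= t%:R^-1 by rewrite -ler_norml.
have c1E : fire1 alpha xi v k t f (X' t) y ns = c1.
  have [c|c] := boolP c1.
    rewrite /fire1 eta1E [(_ + sg) / _]mulrDl vN1 fx'E b1E c.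
    by move: c; rewrite /c1 /fire1 => c; apply/eqP; rewrite eqb_id; lra.
  rewrite /fire1 eta1E [(_ + sg) / _]mulrDl vN1 fx'E b1E (negbTE c).
  by move: c; rewrite /c1 /fire1 -ltNge => c; apply/negbTE; rewrite -ltNge; lra.
(* If [g_1] is answered and either [g_2] is too or PMWG halts, the draw for [g_2] is not shifted;
   the hypothesis excludes this. *)
have eta2E : c1 = false \/ (c2 = false /\ dn = false) ->
    eta2 v k c1 ns = eta2 u k c1 ns1 + (if c1 then s t else sg).
  rewrite /eta2; case: (c1) b1E => b1E; last by rewrite eta1E.
  by case=> // -[c2F dnF]; rewrite vE2 b1E b2E c2F dnF.
(* The answer to [g_2] is left uncontrolled when PMWG halts after answering [g_1]. If both are
   answered without halting, the threshold for [g_2] is unchanged, and raising nu by [Num.max 0 del]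
   makes up for the change [- del] of its value. *)
have c2E : c1 && dn = false -> fire2 alpha xi v k t f (X' t) y c1 ns = c2.
  move=> c1dn; have [c|c] := boolP c2.
    have b2dn : b2 || dn by rewrite b2E c; case: (dn).
    rewrite /fire2 vN2 fx'E b1E b2dn; move: c; rewrite /c2 /fire2.
    case: (boolP c1) => C1.
      have b2T : b2 by move: b2dn; rewrite b2E; move: c1dn; rewrite C1 /= => ->; rewrite orbF.
      rewrite b2T /eta2 vE2 b2T andbF addr0 => c.
      by apply/eqP; rewrite eqb_id; lra.
    rewrite /eta2 eta1E [(_ + sg) / _]mulrDl => c.
    by apply/eqP; rewrite eqb_id; lra.
  have dnF : dn = false.
    by move: c1dn; rewrite dnE (negbTE c) orbF; case: (c1).
  rewrite /fire2 vN2 fx'E b2E dnF (negbTE c) /= if_same addr0.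
  rewrite eta2E; last by right; rewrite (negbTE c).
  rewrite [(_ + (if _ then _ else _)) / _]mulrDl.
  apply/negbTE; rewrite -ltNge; move: c; rewrite /c2 /fire2 -ltNge => c.
  have : t%:R^-1 <= (if c1 then s t else sg) / xi t.
    by case: ifP => _ //; rewrite ler_pdivlMr// mulrC.
  by move: ((if c1 then _ else _) / _) => z; lra.
have aE : c1 || c2 -> dn = false -> answer v k t f (X' t) c1 = answer u k t f (X t) c1.
  rewrite /answer fx'E vZ1 vZ2 b1E b2E => + dnF; rewrite dnF /= !andbT.
  by case: (c1) => /= [_|->]; ring.
have ESE : dn = false -> c2 = false -> ES = if c1 then s t else sg.
  move=> dnF c2F; rewrite /ES b2E c2F dnF b1E !orbF/= /(eta_shift _) /sg.
  by case: (c1).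
(* On halting, once [c1] agrees, it suffices that some query is still answered: [same_run] asks
   nothing more of the state. *)
rewrite c1E; have [dnT|dnF] := boolP dn.
  have /andP[c12 hb] : (c1 || c2) && (hard_query_bound (N := N) n alpha t < H.+1%:R).
    by rewrite -dnE.
  have c12' : c1 || fire2 alpha xi v k t f (X' t) y c1 ns.
    move: c12; case: (boolP c1) => //= C1.
    by rewrite -{1}(negbTE C1) c2E// (negbTE C1).
  by rewrite /query_result c12 c12' hb /=; split => //=; rewrite !andbF.
have {}dnF := negbTE dnF.
rewrite c2E ?dnF ?andbF//.
have nsgE : (if c2 then None else Some (eta2 u k c1 ns1)) =
    omap (fun e => e - ES) (if c2 then None else Some (eta2 v k c1 ns)).
  case: ifP => //= C2; rewrite ESE// eta2E ?addrK//; last by right.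
rewrite /query_result; case c12 : (c1 || c2) => /=; last first.
  by split=> //= _; rewrite nsgE.
rewrite aE//; move: dnE; rewrite dnF c12 /= => <-.
by split=> //= _; rewrite nsgE.
Qed.

End coupling_step.

(** * Privacy cost of an execution *)

Section run_invariant.
Context {R : realType} {N : nat}.
Variables (n : nat) (alpha : R) (xi : nat -> R) (F : query_strategy R N).
Hypothesis F_stream : is_query_stream n F.
Hypothesis n_gt0 : (0 < n)%N.
Hypothesis xi_gt0 : forall t, (0 < t)%N -> 0 < xi t.
Hypothesis s_noninc : forall t t', (0 < t)%N -> (t <= t')%N ->
  xi t' / t'%:R <= xi t / t%:R.
Local Notation run_step := (run_step n alpha xi F).
Local Notation s t := (xi t / t%:R).
Local Notation ghost_of := (ghost_of n).
Local Notation path_cost := (path_cost n xi).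
Local Notation bnd t := (hard_query_bound (N := N) n alpha t).

(* [J t] is the part spent up to time [t] of the budget [Jlim] for the costs
   s_t of the hard queries, of which there may be [bnd t] up to time [t]. *)
Variables (J : nat -> R) (Jlim : R).
Hypothesis bnd_ge0 : 0 <= bnd n.
Hypothesis J_init : J n = bnd n * s n.
Hypothesis J_step : forall t t', (n <= t)%N -> (t <= t')%N ->
  J t + (bnd t' - bnd t) * s t' <= J t'.
Hypothesis J_lim : forall t, (n <= t)%N -> J t <= Jlim.

(** Each hard query pays 3/8 for its own instance and 3/4 in advance for the next one, which starts
    no earlier. The advance of the latest hard query is subtracted in the first line, and the part
    of it spent on eta returns in the last. The second line bounds the sum of the s_tau over the
    hard queries, by summation by parts. *)
Definition potential (g : ghost) : R :=
  3 / 4 * (s n - s (g_mark g)) +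
  9 / 8 * (J (g_mark g) - (bnd (g_mark g) - (g_hard g)%:R) * s (g_mark g)) +
  (if g_start g is Some t then s t / 2 else 0).

Definition run_inv (r : @run R N) : Prop :=
  let g := ghost_of (run_path r) in
  if st_done (run_state r) then
    (path_cost (run_path r) <= s n + 9 / 8 * Jlim : Prop)
  else
    [/\ g_hard g = st_hard (run_state r),
        isSome (g_start g) = isSome (st_nsg (run_state r)),
        (n <= g_mark g)%N /\
          (forall t, g_start g = Some t -> (g_mark g <= t)%N),
        (forall t f, F (run_hist r) = Some (t, f) ->
           (g_mark g <= t)%N /\
           (forall t', g_start g = Some t' -> (t' <= t)%N)) &
        (g_hard g)%:R <= bnd (g_mark g) /\
          path_cost (run_path r) <= potential g].

Lemma s_ge0 t : (0 < t)%N -> 0 <= s t.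
Proof. by move=> t0; rewrite divr_ge0// ltW// xi_gt0. Qed.

(** The running instance started at or after the mark, so its term [s t / 2] is covered by the
    subtracted advance. *)
Lemma potential_le g : (n <= g_mark g)%N ->
  (forall t, g_start g = Some t -> (g_mark g <= t)%N) ->
  (g_hard g)%:R <= bnd (g_mark g) -> potential g <= s n + 9 / 8 * Jlim.
Proof.
move=> nm st hb; rewrite /potential.
have m0 : (0 < g_mark g)%N := leq_trans n_gt0 nm.
have q0 : 0 <= (bnd (g_mark g) - (g_hard g)%:R) * s (g_mark g).
  by rewrite mulr_ge0 ?subr_ge0// s_ge0.
have := J_lim nm; have := s_ge0 m0; have := s_ge0 n_gt0.
case: (g_start g) st => [t|] st; last by lra.
by have := s_noninc m0 (st _ erefl); lra.
Qed.

Lemma run_inv_cost r : run_inv r ->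
  path_cost (run_path r) <= s n + 9 / 8 * Jlim.
Proof.
rewrite /run_inv; case: ifP => // _ [_ _ [nm st] _ [hb]] /le_trans; apply.
exact: potential_le.
Qed.

Lemma run_inv_init : run_inv run_init.
Proof.
split => //=.
  by case: F_stream => Fn _ _ _ _ t f /Fn.
split=> //; rewrite /(path_cost _) big_ord0 /potential /= J_init subr0 !subrr.
by rewrite !mulr0 !addr0.
Qed.

Lemma run_inv_step X u r : run_inv r -> run_inv (run_step X u r).
Proof.
case: r => h st p; rewrite /run_inv /=.
case D : (st_done st) => /=; first by rewrite D path_cost_rcons addr0.
move=> [gH gS [nm mst] gF [hb pot]].
case E : (F h) => [[t f]|] /=; last first.
  rewrite path_cost_rcons addr0; apply: (le_trans pot); exact: potential_le.
have [mt stt] := gF _ _ E.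
set b1 := fire1 _ _ _ _ _ _ _ _ _; set b2 := fire2 _ _ _ _ _ _ _ _ _ _.
set a := answer _ _ _ _ _ _; set eta := eta2 _ _ _ _.
set y := mix_uniform _ _ _.
have next v t' f' : F (rcons h v) = Some (t', f') -> (t <= t')%N.
  by case: F_stream => _ _ Fmono _ _; exact: Fmono E.
have nt : (n <= t)%N := leq_trans nm mt.
have t0 : (0 < t)%N := leq_trans n_gt0 nt.
have m0 : (0 < g_mark (ghost_of p))%N := leq_trans n_gt0 nm.
pose sg := s (odflt t (g_start (ghost_of p))).
have sg_le : sg <= s (g_mark (ghost_of p)).
  rewrite /sg; case S : (g_start (ghost_of p)) => [t1|] /=; apply: s_noninc => //.
  exact: mst.
have q0 : 0 <= (bnd (g_mark (ghost_of p)) - (g_hard (ghost_of p))%:R) *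
    s (g_mark (ghost_of p)).
  by rewrite mulr_ge0 ?subr_ge0// s_ge0.
(* Whether paid earlier or now, the eta of the current instance has cost [sg / 2]. *)
have potE : potential (ghost_of p) +
     (if g_start (ghost_of p) is Some _ then 0 else s t / 2) =
   3 / 4 * (s n - s (g_mark (ghost_of p))) +
   9 / 8 * (J (g_mark (ghost_of p)) - (bnd (g_mark (ghost_of p)) -
     (g_hard (ghost_of p))%:R) * s (g_mark (ghost_of p))) + sg / 2.
  by rewrite /potential /sg; case: (g_start (ghost_of p)) => [t1|] /=; rewrite addr0.
have st_n : s t <= s n by exact: s_noninc.
have st0 := s_ge0 t0.
rewrite /query_result; case b12 : (b1 || b2); last first.
  have [-> ->] : b1 = false /\ b2 = false by move: b12; case: (b1); case: (b2).
  rewrite /= ghost_of_rcons path_cost_rcons /=; split=> //=.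
  - split=> // t1 [<-]; case S : (g_start (ghost_of p)) => [t2|] //=; exact: mst.
  - move=> t' f' /next tt'; split; first exact: leq_trans tt'.
    move=> t1 [<-]; case S : (g_start (ghost_of p)) => [t2|] //=.
    exact: leq_trans (stt _ S) tt'.
  - split=> //; rewrite !addr0.
    by apply: (le_trans (lerD pot (lexx _))); rewrite potE.
case halt : (bnd t < (st_hard st).+1%:R) => /=; rewrite ?ghost_of_rcons path_cost_rcons /=.
  (* PMWG halts: the current instance has used [3/4 * sg], covered by the advance, and the remaining
     [s t / 4 <= s n / 4] completes [3/4 * s n] to [s n]. *)
  rewrite andbF !orbT /= !andbF addr0 addrA.
  apply: (le_trans (lerD (lerD pot (lexx _)) (lexx _))); rewrite potE -/sg.
  by have := J_lim nm; lra.
rewrite andbT orbF b12 !andbT /=; split=> //.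
- by rewrite gH.
- by case: (b2).
- by split=> // t1; case: (b2) => // -[<-].
- move=> t' f' /next tt'; split=> // t1; case: (b2) => // -[<-] //.
split; first by rewrite gH leNgt halt.
(* One step of summation by parts: [J] grows by at least the new allowance weighted by [s t], and
   the allowance left over, nonnegative by [hb], loses weight. *)
have Jt : J (g_mark (ghost_of p)) - (bnd (g_mark (ghost_of p)) -
     (g_hard (ghost_of p))%:R) * s (g_mark (ghost_of p)) <=
   J t - (bnd t - (g_hard (ghost_of p))%:R) * s t.
  have := J_step nm mt.
  have : (bnd (g_mark (ghost_of p)) - (g_hard (ghost_of p))%:R) * s t <=
      (bnd (g_mark (ghost_of p)) - (g_hard (ghost_of p))%:R) * s (g_mark (ghost_of p)).
    by apply: ler_wpM2l; [rewrite subr_ge0|exact: s_noninc].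
  by lra.
rewrite !addrA.
apply: (le_trans (lerD (lerD (lerD (lerD pot (lexx _)) (lexx _)) (lexx _))
  (lexx _))).
rewrite potE -/sg /potential /= -[(g_hard (ghost_of p)).+1%:R]natr1.
by move: b12; case: (b1); case: (b2) => //= _; lra.
Qed.

Lemma run_inv_iter X u k : run_inv (iter k (run_step X u) run_init).
Proof. by elim: k => [|k IH]; [exact: run_inv_init|exact: run_inv_step]. Qed.

End run_invariant.

(** * Hybrid executions *)

Section hybrids.
Context {R : realType} {N : nat}.
Variables (n : nat) (alpha : R) (xi : nat -> R) (F : query_strategy R N).
Hypothesis N_gt0 : (0 < N)%N.
Hypothesis F_stream : is_query_stream n F.
Hypothesis n_gt0 : (0 < n)%N.
Hypothesis xi_gt0 : forall t, (0 < t)%N -> 0 < xi t.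
Hypothesis s_noninc : forall t t', (0 < t)%N -> (t <= t')%N ->
  xi t' / t'%:R <= xi t / t%:R.
Local Notation noise_space := (@noise_space R draw).
Local Notation run_step := (run_step n alpha xi F).
Local Notation s t := (xi t / t%:R).
Local Notation ghost_of := (ghost_of n).
Local Notation label_cost := (label_cost xi).
Local Notation path_cost := (path_cost n xi).
Local Notation eta_shift := (eta_shift xi).
Local Notation bnd t := (hard_query_bound (N := N) n alpha t).
Variables (J : nat -> R) (Jlim : R).
Hypothesis bnd_ge0 : 0 <= bnd n.
Hypothesis J_init : J n = bnd n * s n.
Hypothesis J_step : forall t t', (n <= t)%N -> (t <= t')%N ->
  J t + (bnd t' - bnd t) * s t' <= J t'.
Hypothesis J_lim : forall t, (n <= t)%N -> J t <= Jlim.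
Context {d : measure_display} {Omega : measurableType d}.
Variables (P : probability Omega R) (W : draw -> {RV P >-> R}).
Hypothesis W_noise : is_laplace_noise n xi W.
Variables X X' : nat -> 'rV[R]_N.
Hypothesis sensitivity : forall t f, (n <= t)%N -> is_linear_query f ->
  `|qeval f (X' t) - qeval f (X t)| <= t%:R^-1.

Lemma measurable_run_init : measurable_run 0 (fun=> @run_init R N).
Proof.
split=> // _ [i B mB|b|l|H|j B mB|B mB|p]; exact: measurable_prop.
Qed.

Lemma measurable_run_iter Y k phi i : measurable_run k phi ->
  measurable_run (i + k) (fun u => iter i (run_step Y u) (phi u)).
Proof. by move=> mphi; elim: i => [//|i IH]; exact: measurable_run_step. Qed.

Lemma measurable_shift_nsg k (c : R) (phi : noise_space -> @run R N) :
  measurable_run k phi -> measurable_run k (fun u => shift_nsg c (phi u)).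
Proof.
move=> [sphi mphi]; split.
  by move=> u; have := sphi u; case: (phi u) => h [].
move=> Q QE; have [[B mB ->]|QS] : (exists2 B : set R, measurable B &
    Q = [set r | exists2 z, st_nsg (run_state r) = Some z & B z]) \/
    (forall r, Q (shift_nsg c r) <-> Q r).
  by case: QE => [i B mB|b|l|H|j B mB|B mB|p];
    [right; case=> h []..|left; exists B|right; case=> h []].
- pose B' : set R := (fun z : R => z - c) @^-1` B.
  have mB' : measurable B'.
    by rewrite -[X in measurable X]setTI; exact: measurable_addr.
  rewrite (_ : _ @^-1` _ = phi @^-1`
    [set r | exists2 z, st_nsg (run_state r) = Some z & B' z]).
    exact: (mphi _ (NsgEvent mB')).
  apply/seteqP; split => u /=; case: (phi u) => h [dn l y H [z|]] p //=.
  + by move=> [_ [<-] Bz]; exists z.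
  + by move=> [].
  + by move=> [_ [<-] Bz]; exists (z - c).
  + by move=> [].
- rewrite (_ : _ @^-1` _ = phi @^-1` Q); first exact: mphi.
  by apply/seteqP; split => u /= /QS.
Qed.

(* Passing from [X'] to [X] undoes the shift already made in the draw eta of the
   running instance. *)
Definition hybrid (K : nat) (p : seq label) (j : nat) (u : noise_space) : run :=
  iter (K - j) (run_step X u)
    (shift_nsg (eta_shift (ghost_of (take j p))) (iter j (run_step X' u) run_init)).

Definition hybrid_event K (A : set (transcript R)) p j : set noise_space :=
  [set u | run_path (hybrid K p j u) = p /\
           A (nth None (run_hist (hybrid K p j u)))].

Lemma measurable_run_transcript k (phi : noise_space -> @run R N)
    (A : set (transcript R)) :
  measurable_run k phi -> transcript_measurable A ->
  measurable [set u : noise_space | A (nth None (run_hist (phi u)))].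
Proof.
move=> [_ mphi] mA.
apply: (measurable_preimage_transcript (Y := fun u => nth None (run_hist (phi u))) _ mA).
by move=> _ [i [B [mB ->]]]; exact: (mphi _ (HistEvent i mB)).
Qed.

Lemma measurable_hybrid_event K A p j : transcript_measurable A ->
  measurable (hybrid_event K A p j).
Proof.
move=> mA.
have mh : measurable_run (K - j + (j + 0)) (hybrid K p j).
  apply: measurable_run_iter; apply: measurable_shift_nsg.
  by apply: measurable_run_iter; exact: measurable_run_init.
apply: (@measurableI _ _ [set u | run_path (hybrid K p j u) = p]
  [set u | A (nth None (run_hist (hybrid K p j u)))]).
- exact: (mh.2 _ (PathEvent p)).
- exact: measurable_run_transcript mh mA.
Qed.

Lemma run_hist_shift_nsg c (r : @run R N) : run_hist (shift_nsg c r) = run_hist r.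
Proof. by case: r => h []. Qed.

Lemma run_path_shift_nsg c (r : @run R N) : run_path (shift_nsg c r) = run_path r.
Proof. by case: r => h []. Qed.

Lemma hybrid_path K p j u : (j < K)%N -> run_path (hybrid K p j u) = p ->
  run_path (iter j (run_step X' u) run_init) = take j p /\
  run_path (run_step X u (shift_nsg (eta_shift (ghost_of (take j p)))
    (iter j (run_step X' u) run_init))) = rcons (take j p) (nth None p j).
Proof.
move=> jK; rewrite /hybrid; set r := iter j _ _; set c := eta_shift _.
have -> : (K - j = (K - j.+1).+1)%N by rewrite subnSK.
rewrite iterSr.
have [q -> _] := run_path_iter n alpha xi F X u (K - j.+1)
  (run_step X u (shift_nsg c r)).
have [l ->] := run_path_step n alpha xi F X u (shift_nsg c r).
rewrite run_path_shift_nsg.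
have [q' rE sq'] := run_path_iter n alpha xi F X' u j run_init.
rewrite -/r /= in rE; rewrite rE cat_rcons => <-.
by rewrite -sq' take_size_cat// nth_cat ltnn subnn.
Qed.

(** From the states related by the last hypothesis on, both executions run on [X] with equal draws,
    so [same_run_iter] carries history and path to the end. *)
Lemma hybrid_next K p j u v A : (j < K)%N -> size p = K ->
  hybrid_event K A p j u ->
  iter j (run_step X' v) run_init = iter j (run_step X' u) run_init ->
  (forall e, (j < draw_index e)%N -> u e = v e) ->
  same_run (run_step X u (shift_nsg (eta_shift (ghost_of (take j p)))
      (iter j (run_step X' u) run_init)))
    (shift_nsg (eta_shift (ghost_step (ghost_of (take j p)) (nth None p j)))
      (run_step X' v (iter j (run_step X' u) run_init))) ->
  hybrid_event K A p j.+1 v.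
Proof.
move=> jK pK [pathE Au] itE uv sr.
have takeE : take j.+1 p = rcons (take j p) (nth None p j).
  by rewrite (take_nth None) ?pK.
have [] := @same_run_iter _ _ n alpha xi F X u v _ _ (K - j.+1) sr.
  move=> e; have [w ->] := run_hist_step n alpha xi F X u (shift_nsg
    (eta_shift (ghost_of (take j p))) (iter j (run_step X' u) run_init)).
  by rewrite size_rcons run_hist_shift_nsg size_run_hist addn0; exact: uv.
rewrite -iterSr subnSK// => hE pE _ _.
rewrite /hybrid_event /= /hybrid takeE ghost_of_rcons iterS itE.
by rewrite -hE -pE; split.
Qed.

(** If a query arrives at step [j], only its six draws are shifted: [coupling_step] handles that
    query and [hybrid_next] the later ones. *)
Lemma hybrid_step K p j A : (j < K)%N -> size p = K ->
  transcript_measurable A ->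
  (law W (hybrid_event K A p j) <=
   (expR (label_cost (ghost_of (take j p)) (nth None p j)))%:E *
   law W (hybrid_event K A p j.+1))%E.
Proof.
move=> jK pK mA.
have [indepW lapW] := W_noise; have [Fn Flin _ _ _] := F_stream.
have inv u := run_inv_iter F_stream n_gt0 xi_gt0 s_noninc bnd_ge0 J_init J_step
  J_lim X' u j.
(* A point of the event certifies that the label occurs in an execution, which gives [n <= t] and
   the constraints on the label. *)
have [->|/set0P[u0 Hu0]] := eqVneq (hybrid_event K A p j) set0.
  by rewrite measure0 mule_ge0// lee_fin expR_ge0.
set g := ghost_of (take j p).
case lE : (nth None p j) => [[t [[b1 b2] dn]]|]; last first.
  rewrite expR0 mul1e; apply: le_measure; rewrite ?inE;
    [exact: measurable_hybrid_event..|].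
  move=> u Hu; apply: (hybrid_next jK pK Hu) => //.
  have [pE] := hybrid_path jK Hu.1; rewrite -pE lE.
  case: (iter j (run_step X' u) run_init) => h [dn0 l y H ns] q /=.
  case: dn0 => //=; case: (F h) => [[t f]|] //=.
  by case: query_result => w s' /= /rcons_inj[].
have legal u : hybrid_event K A p j u ->
    let r := iter j (run_step X' u) run_init in
    [/\ ~~ st_done (run_state r), exists f, F (run_hist r) = Some (t, f) &
        b2 && dn = false].
  move=> Hu r; have [_] := hybrid_path jK Hu.1; rewrite -/r lE.
  case: r => h [dn0 l y H ns] q /=.
  case: dn0 => /=; first by move=> /rcons_inj[].
  case: (F h) => [[t' f]|] /=; last by move=> /rcons_inj[].
  case: query_result => w s' /= /rcons_inj[_ -> _ <- <-]; split => //; first by exists f.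
  by rewrite -andbA andNb andbF.
have [/negbTE ndone0 [f0 Ff0] b2dn] := legal _ Hu0.
have tn : (n <= t)%N := Fn _ _ _ Ff0.
have t0 : (0 < t)%N := leq_trans n_gt0 tn.
have start_le t1 : g_start g = Some t1 -> (0 < t1 <= t)%N.
  have := inv u0; rewrite /run_inv ndone0 (hybrid_path jK Hu0.1).1 -/g.
  move=> [_ _ [nm mst] /(_ _ _ Ff0)[_ stt] _] S.
  by rewrite stt// (leq_trans n_gt0 (leq_trans nm (mst _ S))).
(* [law_shift] requires the cost bound at every [u], also outside the event; the default 0 ensures
   it when no query arrives at time [t]. The value depends only on draws before step [j]. *)
pose del u : R := if F (run_hist (iter j (run_step X' u) run_init)) is Some (t', f)
  then (if t' == t then qeval f (X' t) - qeval f (X t) else 0) else 0.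
apply: (law_shift (b := draw_scale xi) indepW
  (es := step_draws j t) (c := fun u => draw_shift xi (g_start g) t b1 b2 dn (del u))).
- exact: uniq_step_draws.
- move=> e ein; split.
    move: ein; rewrite !inE => /or4P[| | |/or3P[]] /eqP -> //=;
    by rewrite divr_gt0// xi_gt0.
  by apply: lapW; move: ein; rewrite !inE => /or4P[| | |/or3P[]] /eqP ->.
- exact: measurable_hybrid_event.
- exact: measurable_hybrid_event.
- move=> u v uv; rewrite /del (@iter_run_step_draws _ _ n alpha xi F X' v u)// => e ej.
  by apply: uv; apply/negP => /step_draws_index ei; rewrite ei ltnn in ej.
- move=> u; apply: draw_shift_cost => //; first exact: xi_gt0.
    case S : (g_start g) => [t1|] /=; last exact: s_ge0.
    by have /andP[t10 _] := start_le _ S; exact: s_ge0.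
  rewrite /del; case E : (F _) => [[t' f]|]; last by rewrite normr0 invr_ge0.
  case: eqP => [tt'|_]; last by rewrite normr0 invr_ge0.
  by apply: sensitivity => //; exact: Flin E.
move=> u Hu; have [ndone [f Ff] _] := legal _ Hu.
have delE : del u = qeval f (X' t) - qeval f (X t) by rewrite /del Ff eqxx.
apply: (hybrid_next jK pK Hu).
- apply: iter_run_step_draws => e ej; rewrite /shift_coords ifF//.
  by apply/negP => /step_draws_index ei; rewrite ei ltnn in ej.
- move=> e ej; rewrite /shift_coords ifF//.
  by apply/negP => /step_draws_index ei; rewrite ei ltnn in ej.
- rewrite lE -/g delE.
  have [pE pE'] := hybrid_path jK Hu.1.
  have szr : size (run_hist (iter j (run_step X' u) run_init)) = j.
    by rewrite size_run_hist addn0.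
  rewrite -[in step_draws j]szr; apply: coupling_step => //.
  + have := inv u; rewrite /run_inv (negbTE ndone) pE -/g.
    by move=> [].
  + by apply: sensitivity => //; exact: Flin Ff.
  + by rewrite pE' lE pE.
Qed.

(** The event is cut along the countably many paths; for each of them the [K] hybrid steps multiply
    up to [expR (path_cost p)]. *)
Lemma finite_horizon_le K (A : set (transcript R)) :
  <<s cylinders_below K >> A ->
  (law W [set u | A (pmwg n alpha xi u F X)] <=
   (expR (s n + 9 / 8 * Jlim))%:E * law W [set u | A (pmwg n alpha xi u F X')])%E.
Proof.
move=> KA.
have mA : transcript_measurable A.
  apply: sub_sigma_algebra2 KA => _ [k [B [_ mB ->]]]; by exists k, B.
have trE Y : [set u | A (pmwg n alpha xi u F Y)] =
    [set u | A (nth None (run_hist (iter K (run_step Y u) run_init)))].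
  have loc u : A (pmwg n alpha xi u F Y) <->
      A (nth None (run_hist (iter K (run_step Y u) run_init))).
    by apply: (cylinders_below_local KA) => k kK; rewrite nth_run_hist.
  by apply/seteqP; split => u /= /loc.
have mrun Y : measurable_run (K + 0) (fun u => iter K (run_step Y u) run_init).
  exact: measurable_run_iter measurable_run_init.
rewrite !trE.
apply: (countable_le_measure (f := fun u => run_path (iter K (run_step X u) run_init))
  (g := fun u => run_path (iter K (run_step X' u) run_init))).
- exact: measurable_run_transcript (mrun X) mA.
- exact: measurable_run_transcript (mrun X') mA.
- by move=> p; exact: ((mrun X).2 _ (PathEvent p)).
- by move=> p; exact: ((mrun X').2 _ (PathEvent p)).
move=> p.
set E0 := _ `&` _; set EK := (Y in (_ * law W Y)%E).
(* A nonempty piece makes [p] the path of an execution on [X], to which [run_inv_cost] applies. *)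
have [->|/set0P[u0 [/= pE0 _]]] := eqVneq E0 set0.
  by rewrite measure0 mule_ge0// lee_fin expR_ge0.
have pK : size p = K.
  have [q] := run_path_iter n alpha xi F X u0 K run_init.
  by rewrite pE0 => ->.
have cost_le : path_cost p <= s n + 9 / 8 * Jlim.
  rewrite -pE0; apply: (run_inv_cost n_gt0 xi_gt0 s_noninc J_lim).
  exact: run_inv_iter.
have E0E : E0 = hybrid_event K A p 0.
  by rewrite /E0 /hybrid_event /hybrid subn0 take0.
have EKE : EK = hybrid_event K A p K.
  apply/seteqP; split => u /=; rewrite /hybrid_event /hybrid subnn /=;
  by rewrite run_hist_shift_nsg run_path_shift_nsg.
rewrite E0E EKE.
have chain j : (j <= K)%N -> (law W (hybrid_event K A p 0) <=
    (expR (\sum_(i < j) label_cost (ghost_of (take i p)) (nth None p i)))%:E *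
    law W (hybrid_event K A p j))%E.
  elim: j => [_|j IH jK]; first by rewrite big_ord0 expR0 mul1e.
  apply: (le_trans (IH (ltnW jK))); rewrite big_ord_recr /= expRD EFinM -muleA.
  by apply: lee_wpmul2l; [rewrite lee_fin expR_ge0|exact: hybrid_step].
apply: (le_trans (chain K (leqnn K))).
apply: lee_wpmul2r => //; rewrite lee_fin ler_expR.
by move: cost_le; rewrite /(path_cost _) pK.
Qed.

Lemma measurable_pmwg Y (A : set (transcript R)) : transcript_cylinders A ->
  measurable ((fun u : noise_space => pmwg n alpha xi u F Y) @^-1` A).
Proof.
move=> [k [B [mB ->]]].
have mrun : measurable_run (k.+1 + 0) (fun u => iter k.+1 (run_step Y u) run_init).
  exact: measurable_run_iter measurable_run_init.
rewrite (_ : _ @^-1` _ = [set u : noise_space | exists2 r,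
    nth None (run_hist (iter k.+1 (run_step Y u) run_init)) k = Some r & B r]).
  exact: (mrun.2 _ (HistEvent k mB)).
have nthE u := nth_run_hist n alpha xi F Y u (ltnSn k).
by apply/seteqP; split => u [r rE Br]; exists r => //; rewrite -rE nthE.
Qed.

Lemma pmwg_law_le (S : set (transcript R)) : transcript_measurable S ->
  (law W [set u | S (pmwg n alpha xi u F X)] <=
   (expR (s n + 9 / 8 * Jlim))%:E * law W [set u | S (pmwg n alpha xi u F X')])%E.
Proof.
apply: (transcript_measure_le (Y := fun u : noise_space => pmwg n alpha xi u F X)
  (Y' := fun u : noise_space => pmwg n alpha xi u F X')).
- exact: measurable_pmwg.
- exact: measurable_pmwg.
- exact: finite_horizon_le.
Qed.

End hybrids.

(** * The budget of hard queries *)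

Section sensitivity.
Context {R : realType} {N : nat}.
Implicit Types f x y : 'rV[R]_N.

Lemma qevalD f x y : qeval f (x + y) = qeval f x + qeval f y.
Proof. by rewrite -big_split; apply: eq_bigr => i _; rewrite mxE mulrDr. Qed.

Lemma qevalZ f (c : R) x : qeval f (c *: x) = c * qeval f x.
Proof. by rewrite mulr_sumr; apply: eq_bigr => i _; rewrite mxE mulrCA. Qed.

Lemma qeval_delta f i : qeval f (delta_mx ord0 i) = f ord0 i.
Proof.
rewrite /qeval (bigD1 i)//= mxE !eqxx mulr1 big1 ?addr0// => j ji.
by rewrite mxE (negbTE ji) andbF mulr0.
Qed.

Lemma stream_sensitivity n (X X' : nat -> 'rV[R]_N) t f :
  neighboring_streams n X X' -> (n <= t)%N -> is_linear_query f ->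
  `|qeval f (X' t) - qeval f (X t)| <= t%:R^-1.
Proof.
move=> [t0 [_ before after]] nt lf; have [tt0|t0t] := ltnP t t0.
  by rewrite before ?nt// subrr normr0 invr_ge0.
have [_ _ [i [j [_ ->]]]] := after _ t0t.
rewrite -scaleNr !qevalD !qevalZ !qeval_delta.
have -> : qeval f (X t) + - t%:R^-1 * f ord0 i + t%:R^-1 * f ord0 j - qeval f (X t)
    = t%:R^-1 * (f ord0 j - f ord0 i) by ring.
rewrite normrM ger0_norm ?invr_ge0// ler_piMr ?invr_ge0// ler_norml.
by have := lf i; have := lf j; lra.
Qed.

End sensitivity.

(** * Convergence of the series of noise levels *)

Section budget.
Context {R : realType}.
Variables (N n : nat) (alpha eps0 : R).
Hypothesis Nn_gt1 : (1 < N * n)%N.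
Hypothesis eps0_gt0 : 0 < eps0.
Hypothesis alpha_gt0 : 0 < alpha.
Local Notation xi := (pmwg_noise N n alpha eps0).
Local Notation s t := (xi t / t%:R).

Lemma universe_gt0 : (0 < N)%N.
Proof. by case: N Nn_gt1. Qed.

Lemma start_gt0 : (0 < n)%N.
Proof. by move: Nn_gt1; case: n => //; rewrite muln0. Qed.

Let kappa : R := alpha ^+ 2 * Num.sqrt n%:R / (162 * ln (N * n)%:R) * eps0.

Let kappa_gt0 : 0 < kappa.
Proof.
rewrite mulr_gt0// divr_gt0 ?mulr_gt0 ?exprn_gt0 ?sqrtr_gt0 ?ltr0n ?start_gt0//.
by rewrite ln_gt0// ltr1n.
Qed.

Lemma pmwg_noise_gt0 t : (0 < t)%N -> 0 < xi t.
Proof. by move=> t0; rewrite mulr_gt0// sqrtr_gt0 ltr0n. Qed.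

Let scale_noise t : (0 < t)%N -> s t = kappa / Num.sqrt t%:R.
Proof.
move=> t0; have st0 : Num.sqrt t%:R != 0 :> R by rewrite gt_eqF// sqrtr_gt0 ltr0n.
rewrite /pmwg_noise -/kappa -mulrA; congr (kappa * _).
rewrite -[X in _ / X](@sqr_sqrtr R) ?ler0n//.
by field.
Qed.

Lemma scaled_noise_nonincreasing t t' : (0 < t)%N -> (t <= t')%N -> s t' <= s t.
Proof.
move=> t0 tt'; have t'0 := leq_trans t0 tt'.
rewrite !scale_noise// ler_pM2l// lef_pV2 ?posrE ?sqrtr_gt0 ?ltr0n//.
by rewrite ler_sqrt ?ltr0n// ler_nat.
Qed.

Lemma bt_ge0 t : (1 < t)%N -> 0 <= bt N t :> R.
Proof.
case: t => [//|[//|t]] _; rewrite /bt /=.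
apply: addr_ge0; first apply: addr_ge0.
- by rewrite divr_ge0// ln_ge0// ler1n universe_gt0.
- by rewrite divr_ge0// ln_ge0// ler1n.
- by rewrite ln_ge0// ler_pdivlMr ?ltr0n// mul1r ler_nat.
Qed.

(** Fourth roots: [ln t <= 4 * q t] and [s t = kappa / q t ^+ 2] make the terms of the series of
    order t^(-5/4), which is summable. *)
Let q (t : nat) : R := Num.sqrt (Num.sqrt t%:R).

Let q_gt0 t : (0 < t)%N -> 0 < q t.
Proof. by move=> t0; rewrite !sqrtr_gt0 ltr0n. Qed.

Let q4 t : q t ^+ 4 = t%:R.
Proof. by rewrite (exprM _ 2 2) !sqr_sqrtr// ?sqrtr_ge0 ?ler0n. Qed.

Let q2 t : q t ^+ 2 = Num.sqrt t%:R.
Proof. by rewrite sqr_sqrtr// sqrtr_ge0. Qed.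

(* With a = t^(1/4) and b = (t + 1)^(1/4), b^4 - a^4 = 1 gives
   b - a >= 1 / (4 b^3). *)
Let inv_pow_le_telescope t : (0 < t)%N ->
  (q t.+1 ^+ 5)^-1 <= 4 * ((q t)^-1 - (q t.+1)^-1).
Proof.
move=> t0; have a0 := q_gt0 t0; have b0 := q_gt0 (ltn0Sn t).
have ab : q t <= q t.+1.
  by rewrite !ler_sqrt ?sqrtr_gt0 ?ltr0n// ?ler_nat// ?sqrtr_ge0.
have : q t.+1 ^+ 4 = q t ^+ 4 + 1 by rewrite !q4 -natr1.
move: (q t) (q t.+1) a0 b0 ab => a b a0 b0 ab ab4.
have -> : a^-1 - b^-1 = (b - a) / (a * b) by field; rewrite !gt_eqF.
rewrite mulrA ler_pdivlMr ?mulr_gt0// mulrC ler_pdivrMr ?exprn_gt0//.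
have h1 : 1 <= (b - a) * (4 * b ^+ 3).
  have e : (b - a) * ((b + a) * (b ^+ 2 + a ^+ 2)) = 1.
    have -> : (b - a) * ((b + a) * (b ^+ 2 + a ^+ 2)) = b ^+ 4 - a ^+ 4 by ring.
    by rewrite ab4 addrAC subrr add0r.
  rewrite -[leLHS]e; apply: ler_wpM2l; first by rewrite subr_ge0.
  have -> : 4 * b ^+ 3 = (b + b) * (b ^+ 2 + b ^+ 2) by ring.
  apply: ler_pM.
  - by rewrite addr_ge0// ltW.
  - by rewrite addr_ge0// sqr_ge0.
  - by rewrite lerD2l.
  - by rewrite lerD2l; apply: lerXn2r => //; rewrite nnegrE ltW.
have -> : 4 * (b - a) * b ^+ 5 = (b - a) * (4 * b ^+ 3) * (b * b) by ring.
apply: (@le_trans _ _ (1 * (b * b))); first by rewrite mul1r ler_wpM2r// ltW.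
by rewrite ler_wpM2r// mulr_ge0 ?ltW.
Qed.

(** The constant 6 is 4 + 2, from [ln t <= 4 * q t.+1] and [ln (t.+1 / t) <= 1 / t <= 2 / t.+1]; the
    factor 4 comes from the telescoping bound. *)
Let term_le t : (0 < t)%N -> bt N t.+1 * s t.+1 <=
  kappa * (ln N%:R + 6) * 4 * ((q t)^-1 - (q t.+1)^-1).
Proof.
move=> t0; have b0 := q_gt0 (ltn0Sn t).
have b1 : 1 <= q t.+1.
  by rewrite -(@expr_ge1 _ 4)// ?q4 ?ler1n// ltW.
have lnN : 0 <= ln N%:R :> R by rewrite ln_ge0// ler1n universe_gt0.
have bnd : bt N t.+1 <= (ln N%:R + 6) * q t.+1 / t.+1%:R :> R.
  have tR : 0 < t%:R :> R by rewrite ltr0n.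
  have tR1 : 0 < t.+1%:R :> R by rewrite ltr0n.
  have l1 : ln t%:R <= 4 * q t.+1.
    apply: (@le_trans _ _ (ln t.+1%:R)); first by rewrite ler_ln ?posrE// ler_nat.
    rewrite -q4 lnXn// -[leLHS]mulr_natl ler_pM2l//.
    exact/ltW/ln_sublinear.
  have l2 : ln (t.+1%:R / t%:R) <= 2 * q t.+1 / t.+1%:R :> R.
    apply: (@le_trans _ _ t%:R^-1).
      have -> : t.+1%:R / t%:R = 1 + t%:R^-1 :> R.
        by rewrite -natr1 mulrDl mul1r divff ?gt_eqF// addrC.
      by apply: le_ln1Dx; rewrite (lt_trans (ltrN10 _))// invr_gt0.
    rewrite ler_pdivlMr// mulrC ler_pdivrMr//.
    apply: (@le_trans _ _ (2 * t%:R)); last first.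
      by rewrite ler_pM2r// ler_peMr.
    by rewrite -natrM ler_nat mul2n -addnn -addn1 leq_add2l.
  rewrite /bt /=.
  have -> : (ln N%:R + 6) * q t.+1 / t.+1%:R =
     ln N%:R * q t.+1 / t.+1%:R + 4 * q t.+1 / t.+1%:R + 2 * q t.+1 / t.+1%:R by ring.
  apply: lerD => //; apply: lerD; rewrite ler_pM2r ?invr_gt0//.
  exact: ler_peMr.
apply: (@le_trans _ _ (kappa * (ln N%:R + 6) * (q t.+1 ^+ 5)^-1)); last first.
  rewrite -[leRHS]mulrA; apply: ler_wpM2l; last exact: inv_pow_le_telescope.
  by rewrite mulr_ge0 ?addr_ge0// ltW.
apply: (@le_trans _ _ ((ln N%:R + 6) * q t.+1 / t.+1%:R * s t.+1)).
  by rewrite ler_wpM2r// ltW// divr_gt0 ?pmwg_noise_gt0 ?ltr0n.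
rewrite scale_noise// -(q2 t.+1) -(q4 t.+1).
have -> : (ln N%:R + 6) * q t.+1 / q t.+1 ^+ 4 * (kappa / q t.+1 ^+ 2) =
  kappa * (ln N%:R + 6) * (q t.+1 ^+ 5)^-1 by field; rewrite gt_eqF.
by [].
Qed.

Let partial (m : nat) : R := \sum_(n.+1 <= t < m) bt N t * s t.

Let partial_nondecreasing : nondecreasing_seq partial.
Proof.
apply/nondecreasing_seqP => m; rewrite /partial.
have [mn|nm] := leqP m n; first by rewrite !big_geq// ltnW.
rewrite big_nat_recr//= lerDl mulr_ge0 ?bt_ge0//.
  by rewrite (leq_ltn_trans start_gt0).
by rewrite divr_ge0// ltW// pmwg_noise_gt0// (leq_ltn_trans _ nm).
Qed.

(** Boundedness makes the series converge, so that [limn] is its sum and not a default value. *)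
Let partial_bounded : has_ubound (range partial).
Proof.
pose C := kappa * (ln N%:R + 6) * 4.
have C0 : 0 <= C.
  have lnN : 0 <= ln N%:R :> R by rewrite ln_ge0// ler1n universe_gt0.
  by rewrite mulr_ge0// mulr_ge0 ?addr_ge0// ltW.
exists (C * (q n)^-1) => _ [m _ <-].
have [mn|nm] := leqP m n.
  by rewrite /partial big_geq ?(leq_trans mn)// mulr_ge0// invr_ge0 ltW// q_gt0// start_gt0.
(* The sum stops at [m - 1]; the negative term is what lets the induction telescope. *)
apply: (@le_trans _ _ (C * ((q n)^-1 - (q m.-1)^-1))); last first.
  by rewrite ler_wpM2l// lerBlDr lerDl invr_ge0 sqrtr_ge0.
rewrite -(subnKC nm) addSn /=; elim: (m - n.+1)%N => [|k IH].
  by rewrite /partial big_geq ?addn0// subrr mulr0.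
rewrite /partial addnS big_nat_recr ?ltnS ?leq_addr//=.
apply: (le_trans (lerD IH (term_le _))); first by rewrite addn_gt0 start_gt0.
by rewrite -/C -mulrDr ler_wpM2l//; lra.
Qed.

Let beta : R := 36 / alpha ^+ 2.

(** The instance of [J]: each increment of [hard_query_bound] is weighted by [s] at its own time.
    The argument [t.+1] is an exclusive upper limit. *)
Definition hard_budget (t : nat) : R :=
  beta * (ln N%:R * s n + partial t.+1).

Definition total_budget : R := beta * (ln N%:R * s n + limn partial).

Let beta_ge0 : 0 <= beta. Proof. by rewrite divr_ge0// sqr_ge0. Qed.

Lemma hard_query_bound_ge0 : 0 <= hard_query_bound (N := N) n alpha n.
Proof.
by rewrite /hard_query_bound big_geq// addr0 mulr_ge0// ln_ge0// ler1n universe_gt0.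
Qed.

Lemma hard_budget_init :
  hard_budget n = hard_query_bound (N := N) n alpha n * s n.
Proof.
by rewrite /hard_budget /hard_query_bound /partial !big_geq// !addr0 mulrA.
Qed.

(** The increments after [t] are nonnegative and weighted by [s i >= s t'], as [i <= t']. *)
Lemma hard_budget_step t t' : (n <= t)%N -> (t <= t')%N ->
  hard_budget t + (hard_query_bound (N := N) n alpha t' -
    hard_query_bound (N := N) n alpha t) * s t' <= hard_budget t'.
Proof.
move=> nt tt'; rewrite /hard_budget /hard_query_bound /partial -/beta.
have cat G : \sum_(n.+1 <= i < t'.+1) G i =
    \sum_(n.+1 <= i < t.+1) G i + \sum_(t.+1 <= i < t'.+1) G i :> R.
  by rewrite -big_cat_nat.
rewrite !cat.
have : (\sum_(t.+1 <= i < t'.+1) bt N i) * s t' <=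
    \sum_(t.+1 <= i < t'.+1) bt N i * s i.
  rewrite mulr_suml !big_nat; apply: ler_sum => i /andP[ti it'].
  apply: ler_wpM2l; first by rewrite bt_ge0// (leq_ltn_trans start_gt0)// (leq_ltn_trans nt).
  by apply: scaled_noise_nonincreasing => //; exact: leq_ltn_trans ti.
move: (\sum_(t.+1 <= i < t'.+1) bt N i)
  (\sum_(t.+1 <= i < t'.+1) bt N i * s i) => A B AB.
have := ler_wpM2l beta_ge0 AB; lra.
Qed.

Lemma hard_budget_le t : (n <= t)%N -> hard_budget t <= total_budget.
Proof.
move=> _; rewrite ler_wpM2l// lerD2l.
apply: nondecreasing_cvgn_le => //.
exact: nondecreasing_is_cvgn.
Qed.

End budget.

Theorem theorem23 (R : realType) (N n : nat) (eps0 alpha : R)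
    (d : measure_display) (Omega : measurableType d) (P : probability Omega R)
    (W : draw -> {RV P >-> R}) (F : query_strategy R N)
    (hNn : (1 < N * n)%N) (heps0 : 0 < eps0) (halpha : 0 < alpha) :
  let xi := pmwg_noise N n alpha eps0 in
  let Delta (t : nat) : R := t%:R^-1 in
  is_laplace_noise n xi W ->
  is_query_stream n F ->
  differentially_private n P
    (fun X w => pmwg n alpha xi (fun e => W e w) F X)
    ((1 + 81 / (2 * alpha ^+ 2) * ln N%:R) * (xi n * Delta n) +
     81 / (2 * alpha ^+ 2) *
       limn (fun m => \sum_(n.+1 <= t < m) bt N t * (xi t * Delta t))).
Proof.
move=> xi Delta W_noise F_stream X X' _ _ XX' S mS.
(* The constant arises as 9/8 times [36 / alpha ^+ 2]. *)
have -> : (1 + 81 / (2 * alpha ^+ 2) * ln N%:R) * (xi n * Delta n) +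
     81 / (2 * alpha ^+ 2) *
       limn (fun m => \sum_(n.+1 <= t < m) bt N t * (xi t * Delta t)) =
    xi n / n%:R + 9 / 8 * total_budget N n alpha eps0.
  rewrite /total_budget /Delta /xi; set l := limn _; set x := pmwg_noise _ _ _ _ n.
  move: l x => l x.
  by field; rewrite pnatr_eq0 -lt0n (start_gt0 hNn) gt_eqF.
have sens t f (nt : (n <= t)%N) (lf : is_linear_query f) :=
  stream_sensitivity XX' nt lf.
exact: (pmwg_law_le (universe_gt0 hNn) F_stream (start_gt0 hNn)
  (pmwg_noise_gt0 hNn heps0 halpha)
  (scaled_noise_nonincreasing hNn heps0 halpha) (hard_query_bound_ge0 alpha hNn)
  (hard_budget_init _ _ _ _) (hard_budget_step hNn heps0 halpha)
  (hard_budget_le hNn heps0 halpha) W_noise sens mS).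
Qed.
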